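(* Let $\mathfrak g$ be a real finite-dimensional Lie algebra with a symplectic structure $\omega$ and a non-degenerate symmetric bilinear form $g$. Let $V$ be the underlying vector space of $\mathfrak g$, let $\gamma:\mathfrak g\to\mathrm{End}(V)$ be a torsion-free flat symplectic connection, and let $\mathfrak h=\mathfrak g\ltimes_\gamma V$ be the associated semi-direct product, with its natural complex structure $J$, symplectic structure $\Omega_3$, pseudo-metric $\Delta$ and symplectic structure $\Omega_2$. If $(J,\Delta)$ is a pseudo-K\''ahler structure on $\mathfrak h$ and if $$(g^{-1}\omega)(\gamma(a)b)=\gamma\big((g^{-1}\omega)(a)\big)\big((g^{-1}\omega)(b)\big)\quad\text{for all }a,b\in\mathfrak g,$$ then there exists a deformation, through (invariant) generalized complex structures on $\mathfrak h$, from the complex structure $J$ to the symplectic structure $\Omega_2$ (up to a $B$-field transformation by a closed 2-form), such that $\mathrm{DGA}(J)$ is isomorphic to $\mathrm{DGA}(\Omega_2)$.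
   Context: A symplectic structure on a Lie algebra is a non-degenerate $\omega\in\wedge^2\mathfrak g^*$ closed for the Chevalley-Eilenberg differential. $\gamma$ being a torsion-free flat symplectic connection means that $\gamma$ is linear and for all $x,y,z\in\mathfrak g$ (identifying $V=\mathfrak g$): $\gamma(x)y-\gamma(y)x=[x,y]$; $\omega(\gamma(x)y,z)+\omega(y,\gamma(x)z)=0$; $\gamma([x,y])=\gamma(x)\gamma(y)-\gamma(y)\gamma(x)$. $\mathfrak h=\mathfrak g\oplus V$ has brackets $[(x,0),(y,0)]=([x,y],0)$, $[(x,0),(0,v)]=(0,\gamma(x)v)$, $[(0,u),(0,v)]=0$. Put $J(x,y)=(-y,x)$, $\Omega_2((x,u),(y,v))=\omega(x,y)-\omega(u,v)$, $\Omega_3((x,u),(y,v))=\omega(x,y)+\omega(u,v)$, $\Delta((x,u),(y,v))=g(x,y)+g(u,v)$. $(J,\Delta)$ is pseudo-K\''ahler if $\Omega_4((x,u),(y,v)):=\Delta(J(x,u),(y,v))=g(x,v)-g(y,u)$ is a closed 2-form on $\mathfrak h$. Bilinear forms are viewed as maps by contraction in the first slot; $g^{-1}\omega:V\to V$ is determined by $g((g^{-1}\omega)(a),b)=\omega(a,b)$. Invariant generalized complex geometry: on $(\mathfrak h\oplus\mathfrak h^* )_{\mathbb C}$ use the pairing $\langle X+\alpha,Y+\beta\rangle=\frac12(\alpha(Y)+\beta(X))$ and bracket $[\![X+\alpha,Y+\beta]\!]=[X,Y]+\mathcal L_X\beta-\mathcal L_Y\alpha-\frac12d(\beta(X)-\alpha(Y))$,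 where the last term vanishes and $(\mathcal L_X\beta)(Z)=-\beta([X,Z])$. A generalized complex structure is a maximal isotropic complex subspace $L$, closed under the bracket, with $L\cap\overline L=0$. For $J$: $L=\mathfrak h^{1,0}\oplus\mathfrak h^{*(0,1)}$; for a symplectic form $\Omega$: $L=\{X-i\iota_X\Omega:X\in\mathfrak h_{\mathbb C}\}$. The $B$-field transformation by a closed 2-form $B$ sends $X+\alpha$ to $X+\alpha+\iota_XB$. The DGA (differential Gerstenhaber algebra) of a generalized complex structure $L$ is $\wedge^\bullet L$ with exterior product, the Schouten extension of $[\![-,-]\!]$ from $L$ to $\wedge^\bullet L$, and the differential $\overline\partial$: the Lie algebra (Chevalley-Eilenberg) differential of $\overline L$, acting on $\wedge^\bullet L\cong\wedge^\bullet\overline L^*$ via $2\langle-,-\rangle$. Isomorphism of DGAs means a graded linear isomorphism compatible with product, bracket and differential. A deformation of $L$ is given by $\Gamma\in\wedge^2L$ with $\overline\partial\Gamma+\frac12[\![\Gamma,\Gamma]\!]=0$ (such that the result is again a generalized complex structure): the deformed structure is $L_{\overline\Gamma}=\{\ell+\overline\Gamma(\ell):\ell\in L\}$, with $\overline\Gamma(\ell)=\iota_\ell\overline\Gamma\in\overline L$. *)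

(* Defs.v *)
From HB Require Import structures.
From mathcomp Require Import all_boot all_order all_fingroup all_algebra.
From mathcomp Require Import complex.
From mathcomp Require Import all_classical all_reals all_analysis.

Set Implicit Arguments.
Unset Strict Implicit.
Unset Printing Implicit Defensive.

Import Order.TTheory GRing.Theory Num.Theory.
Import numFieldNormedType.Exports.

Local Open Scope classical_set_scope.
Local Open Scope ring_scope.
Local Open Scope complex_scope.

(* A k-form on E is a function of k-tuples of vectors; [is_form] singles out
   the alternating multilinear ones.  All operations below are total and are
   only meaningful on such forms. *)
Section Forms.
Variables (F : fieldType) (E : lmodType F).

Definition form (k : nat) := ('I_k -> E) -> F.

Definition subst k (v : 'I_k -> E) (i : 'I_k) (u : E) : 'I_k -> E :=
  fun j => if j == i then u else v j.

Definition vcons k (u : E) (v : 'I_k -> E) : 'I_k.+1 -> E :=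
  fun i => oapp v u (unlift ord0 i).

Definition is_form k (a : form k) : Prop :=
  (forall (v : 'I_k -> E) (i : 'I_k), scalar (fun u => a (subst v i u))) /\
  (forall (v : 'I_k -> E) (i j : 'I_k), i != j -> v i = v j -> a v = 0).

Definition form1 (f : E -> F) : form 1 := fun v => f (v ord0).
Definition form2 (f : E -> E -> F) : form 2 := fun v => f (v ord0) (v ord_max).

Definition contract k (u : E) (a : form k.+1) : form k := fun v => a (vcons u v).

(* Determinant normalization: (x /\ y)(a, b) = x(a) y(b) - x(b) y(a). *)
Definition wedge p q (a : form p) (b : form q) : form (p + q) :=
  fun v => (p`! * q`!)%:R^-1 *
    \sum_(s : 'S_(p + q)) (-1) ^+ s *
      (a (fun i => v (s (lshift q i))) * b (fun j => v (s (rshift p j)))).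

(* Chevalley-Eilenberg differential (trivial coefficients),
     (d a)(v_0, .., v_k)
       = \sum_(i < j') (-1)^(i + j') a([v_i, v_j'], v_0, .^i., .^j'., v_k);
   here j' = lift i j, which for i <= j is j + 1. *)
Definition ce_d (br : E -> E -> E) (k : nat) : form k -> form k.+1 :=
  match k with
  | 0 => fun _ _ => 0
  | m.+1 => fun a v =>
      \sum_(i < m.+2) \sum_(j < m.+1 | (i <= j)%N)
        (-1) ^+ (i + j.+1) *
          a (vcons (br (v i) (v (lift i j))) (fun l => v (lift i (lift j l))))
  end.

End Forms.

Section LieAlgebra.
Variables (F : fieldType) (V : lmodType F).

Definition is_lie_bracket (br : V -> V -> V) : Prop :=
  [/\ (forall x, linear (br x)),
      (forall y, linear (br^~ y)),
      (forall x, br x x = 0) &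
      (forall x y z, br x (br y z) + br y (br z x) + br z (br x y) = 0)].

Definition nondegenerate_form (f : V -> V -> F) : Prop :=
  forall x, (forall y, f x y = 0) -> x = 0.

Definition closed_2form (br : V -> V -> V) (f : V -> V -> F) : Prop :=
  is_form (form2 f) /\ forall v, ce_d br (form2 f) v = 0.

Definition symplectic_form (br : V -> V -> V) (f : V -> V -> F) : Prop :=
  closed_2form br f /\ nondegenerate_form f.

Definition nondegenerate_symmetric (f : V -> V -> F) : Prop :=
  [/\ (forall x, scalar (f x)), (forall x y, f x y = f y x) &
      nondegenerate_form f].

End LieAlgebra.

Section SemiDirect.
Variables (R : realType) (V : vectType R).

Definition torsion_free_flat_symplectic
    (br : V -> V -> V) (w : V -> V -> R) (gamma : V -> 'End(V)) : Prop :=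
  [/\ linear gamma,
      (forall x y, gamma x y - gamma y x = br x y),
      (forall x y z, w (gamma x y) z + w y (gamma x z) = 0) &
      (forall x y z,
         gamma (br x y) z = gamma x (gamma y z) - gamma y (gamma x z))].

Definition sd_bracket (br : V -> V -> V) (gamma : V -> 'End(V))
    (X Y : V * V) : V * V :=
  (br X.1 Y.1, gamma X.1 Y.2 - gamma Y.1 X.2).

Definition sd_J (X : V * V) : V * V := (- X.2, X.1).

Definition sd_Omega2 (w : V -> V -> R) (X Y : V * V) : R :=
  w X.1 Y.1 - w X.2 Y.2.

Definition sd_Delta (g : V -> V -> R) (X Y : V * V) : R :=
  g X.1 Y.1 + g X.2 Y.2.

Definition pseudo_kahler (br : V * V -> V * V -> V * V)
    (J : V * V -> V * V) (D : V * V -> V * V -> R) : Prop :=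
  closed_2form br (fun X Y => D (J X) Y).

End SemiDirect.

(* [cplx V] is the complexification of V; the pair (x, y) stands for x + i y. *)
Definition cplx (R : rcfType) (V : lmodType R) : Type := (V * V)%type.

Section Complexification.
Variables (R : rcfType) (V : lmodType R).

HB.instance Definition _ := GRing.Zmodule.on (cplx V).

Definition cscale (a : R[i]) (X : cplx V) : cplx V :=
  (complex.Re a *: X.1 - complex.Im a *: X.2,
   complex.Re a *: X.2 + complex.Im a *: X.1).

Fact cscaleA a b X : cscale a (cscale b X) = cscale (a * b) X.
Proof.
case: a b X => [a a'] [b b'] [x y]; rewrite /cscale /=.
congr pair; rewrite /= !scalerBr !scalerDr !scalerA ?scalerBl ?scalerDl.
  by rewrite !opprD [- _ - _ in LHS]addrC addrACA.
by rewrite [_ *: _ - _ in LHS]addrC addrACA.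
Qed.

Fact cscale1 : left_id 1 cscale.
Proof. by case=> x y; rewrite /cscale /= !scale1r !scale0r subr0 addr0. Qed.

Fact cscaleDr : right_distributive cscale +%R.
Proof.
move=> a [x y] [z t]; rewrite /cscale /=.
by congr pair; rewrite /= !scalerDr ?opprD addrACA.
Qed.

Fact cscaleDl X : {morph cscale^~ X : a b / a + b}.
Proof.
case: X => x y [a a'] [b b']; rewrite /cscale /=.
by congr pair; rewrite /= !scalerDl ?opprD addrACA.
Qed.

HB.instance Definition _ :=
  GRing.Zmodule_isLmodule.Build R[i] (cplx V)
    cscaleA cscale1 cscaleDr cscaleDl.

Definition cconj (X : cplx V) : cplx V := (X.1, - X.2).

End Complexification.

Fact cplx_vect_iso (R : rcfType) (V : vectType R) :
  Vector.axiom (\dim (fullv : {vspace V})) (cplx V).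
Proof.
pose e := vbasis (fullv : {vspace V}).
have eb : basis_of fullv e by exact: vbasisP.
exists (fun X : cplx V => \row_j (coord e j X.1 +i* coord e j X.2)).
  move=> [a a'] [x y] [z t]; apply/rowP => j; rewrite !mxE /=.
  rewrite !linearD !linearN !linearZ /= scalerN; apply/eqP.
  by rewrite eq_complex /= !eqxx.
exists (fun r : 'rV_(\dim fullv) => (\sum_j complex.Re (r 0 j) *: e`_j,
                  \sum_j complex.Im (r 0 j) *: e`_j) : cplx V).
  case=> x y /=; congr pair.
    by rewrite [RHS](coord_vbasis (memvf x)); apply: eq_bigr => j _; rewrite mxE.
  by rewrite [RHS](coord_vbasis (memvf y)); apply: eq_bigr => j _; rewrite mxE.
move=> r; apply/rowP => j; rewrite !mxE /= !coord_sum_free ?(basis_free eb) //.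
by case: (r 0 j).
Qed.

HB.instance Definition _ (R : rcfType) (V : vectType R) :=
  Lmodule_hasFinDim.Build R[i] (cplx V) (@cplx_vect_iso R V).

(* Complex-(bi)linear extensions of real (bi)linear maps. *)
Definition cmap (R : rcfType) (V W : lmodType R) (f : V -> W)
  (X : cplx V) : cplx W := (f X.1, f X.2).

Definition cbil (R : rcfType) (V W : lmodType R) (f : V -> V -> W)
    (X Y : cplx V) : cplx W :=
  (f X.1 Y.1 - f X.2 Y.2, f X.1 Y.2 + f X.2 Y.1).

Definition cpair (R : rcfType) (V : lmodType R) (f : V -> V -> R)
    (X Y : cplx V) : R[i] :=
  (f X.1 Y.1 - f X.2 Y.2) +i* (f X.1 Y.2 + f X.2 Y.1).

Section GeneralizedComplex.
Variables (R : realType) (h : vectType R) (br : h -> h -> h).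

Local Notation dual := 'Hom(h, R^o).
Local Notation dbl := (h * dual)%type.
Local Notation cdbl := (cplx dbl).

Definition pairing (e f : dbl) : R := 2^-1 * (e.2 f.1 + f.2 e.1).

Definition lie_der (X : h) (b : dual) : dual :=
  linfun (fun Z : h => (- b (br X Z) : R^o)).

(* The term d(beta(X) - alpha(Y)) of the bracket is the differential of a
   constant and is therefore omitted. *)
Definition dorfman (e f : dbl) : dbl :=
  (br e.1 f.1, lie_der e.1 f.2 - lie_der f.1 e.2).

Definition cpairing : cdbl -> cdbl -> R[i] := cpair pairing.
Definition cbracket : cdbl -> cdbl -> cdbl := cbil dorfman.

(* [cconj] is only semilinear, hence the span of the conjugates of a basis. *)
Definition conj_space (L : {vspace cdbl}) : {vspace cdbl} :=
  <<[seq cconj l | l : cdbl <- vbasis L]>>%VS.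

Definition isotropic (L : {vspace cdbl}) : Prop :=
  forall l m, l \in L -> m \in L -> cpairing l m = 0.

Definition is_gcs (L : {vspace cdbl}) : Prop :=
  [/\ isotropic L,
      (forall L' : {vspace cdbl}, isotropic L' -> (L <= L')%VS -> L' = L),
      (forall l m, l \in L -> m \in L -> cbracket l m \in L) &
      (L :&: conj_space L)%VS = 0%VS].

Definition vec_part (X : cplx h) : cdbl := cmap (fun x : h => (x, 0) : dbl) X.
Definition cov_part (a : cplx dual) : cdbl :=
  cmap (fun b : dual => (0, b) : dbl) a.

Definition pullback (J : h -> h) (a : dual) : dual :=
  linfun (fun Z : h => a (J Z)).

Definition h10 (J : h -> h) : {vspace cplx h} :=
  passmx.leigenspace (linfun (cmap J : cplx h -> cplx h)) 'i%C.

(* alpha o J = - i alpha, i.e. alpha vanishes on h10. *)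
Definition hstar01 (J : h -> h) : {vspace cplx dual} :=
  passmx.leigenspace
    (linfun (cmap (pullback J) : cplx dual -> cplx dual)) (- 'i%C).

Definition gcs_complex (J : h -> h) : {vspace cdbl} :=
  (linfun vec_part @: h10 J + linfun cov_part @: hstar01 J)%VS.

Definition int_prod (f : h -> h -> R) (X : h) : dual :=
  linfun (f X : h -> R^o).

Definition gcs_symplectic (Om : h -> h -> R) : {vspace cdbl} :=
  limg (linfun (fun X : cplx h =>
    vec_part X - 'i%C *: cov_part (cmap (int_prod Om) X))).

Definition b_transform (B : h -> h -> R) (L : {vspace cdbl}) : {vspace cdbl} :=
  (linfun (cmap (fun e : dbl => (e.1, e.2 + int_prod B e.1) : dbl)
             : cdbl -> cdbl) @: L)%VS.

(* For a generalized complex structure L, the pairing 2<-,-> identifies L with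
   the dual of conj L, hence the k-th exterior power of L with the alternating
   k-forms on conj L; elements of the DGA of L are represented by the latter. *)
Section DGA.
Variable L : {vspace cdbl}.

Definition lbar : vectType R[i] := subvs_of (conj_space L).
Definition multivector (k : nat) := form lbar k.

Definition lbar_bracket (a b : lbar) : lbar :=
  vsproj (conj_space L) (cbracket (vsval a) (vsval b)).

Definition flat (l : cdbl) (b : lbar) : R[i] := 2 * cpairing l (vsval b).

(* The element of L corresponding to a linear functional on conj L. *)
Definition sharp (phi : lbar -> R[i]) : cdbl :=
  xget 0 [set l | l \in L /\ forall b, flat l b = phi b].

Definition dbar (k : nat) : multivector k -> multivector k.+1 :=
  ce_d lbar_bracket (k := k).

(* With e a basis of conj L and e^* the dual basis of L,
     [P, Q] = \sum_(i, j) [e^*_i, e^*_j] /\ iota_(e_i) P /\ iota_(e_j) Q,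
   i.e. on decomposable elements
     [x_1 .. x_p, y_1 .. y_q]
       = \sum_(i, j) (-1)^(i+j) [x_i, y_j] x_1 .^i. x_p y_1 .^j. y_q.
   The bracket with an element of degree 0 is zero, whence the degrees. *)
Definition schouten p q (P : multivector p.+1) (Q : multivector q.+1) :
    multivector (1 + p + q) :=
  let e := vbasis (fullv : {vspace lbar}) in
  fun v => \sum_i \sum_j
    wedge (wedge
      (form1 (flat (cbracket (sharp (coord e i)) (sharp (coord e j)))))
      (contract e`_i P)) (contract e`_j Q) v.

Definition maurer_cartan (G : multivector 2) : Prop :=
  forall v, dbar G v + 2^-1 * schouten (G : multivector 1.+1) G v = 0.

(* conj G (l) = conj (G (conj l)), with G(b) = iota_b G viewed in L. *)
Definition conj_contract (G : multivector 2) (l : cdbl) : cdbl :=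
  cconj (sharp (fun b =>
    G (vcons (vsproj (conj_space L) (cconj l)) (fun=> b)))).

(* The set of all l + conj G (l) with l in L. *)
Definition deformed (G : multivector 2) : {vspace cdbl} :=
  <<[seq (l + conj_contract G l)%R | l : cdbl <- vbasis L]>>%VS.

End DGA.

Definition dga_iso (L1 L2 : {vspace cdbl}) : Prop :=
  exists phi : forall k, multivector L1 k -> multivector L2 k,
  [/\ forall k, set_bij [set a | is_form a] [set b | is_form b] (phi k),
      forall k c (a b : multivector L1 k), is_form a -> is_form b ->
        phi k (fun v => c * a v + b v) = (fun v => c * phi k a v + phi k b v),
      forall p q (a : multivector L1 p) (b : multivector L1 q),
        is_form a -> is_form b ->
        phi (p + q)%N (wedge a b) = wedge (phi p a) (phi q b),
      forall k (a : multivector L1 k), is_form a ->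
        phi k.+1 (dbar a) = dbar (phi k a) &
      forall p q (a : multivector L1 p.+1) (b : multivector L1 q.+1),
        is_form a -> is_form b ->
        phi (1 + p + q)%N (schouten a b) = schouten (phi p.+1 a) (phi q.+1 b)].

(* A continuous path, starting at L, of generalized complex structures
   obtained from L by deformation, and ending at L'. *)
Definition deforms_to (L L' : {vspace cdbl}) : Prop :=
  exists G : R -> multivector L 2,
  [/\ forall t, 0 <= t <= 1 ->
        [/\ is_form (G t), maurer_cartan (G t) & is_gcs (deformed (G t))],
      forall v, {within `[0, 1], continuous (fun t => complex.Re (G t v))} /\
                {within `[0, 1], continuous (fun t => complex.Im (G t v))},
      G 0 = (fun=> 0) &
      deformed (G 1) = L'].

End GeneralizedComplex.

(* Main.v *)
Require Import Defs.
From HB Require Import structures.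
From mathcomp Require Import all_boot all_order all_fingroup all_algebra.
From mathcomp Require Import complex ring lra.
From mathcomp Require Import all_classical all_reals all_analysis.

(* Put Omega_1((x, u), (y, v)) = w(x, v) + w(u, y).  Then Omega_2 + i Omega_1 is a
   holomorphic symplectic form for J.  Deforming J by t times its inverse Poisson
   structure gives, for t <> 0, the B-field transform by - Omega_1 / t of the
   symplectic structure Omega_2 / t.

   For the second claim, both structures are parametrized by the complexification
   of h, in such a way that brackets correspond and that L and its conjugate are
   paired by - 2 i Omega_1 for J, and by - 2 i Omega_2 for Omega_2.  It remains to
   find automorphisms P and Q of h with Omega_2(P X, Q Y) = Omega_1(X, Y).  The
   hypotheses on phi imply gamma o phi^2 = gamma; moreover the components gp and
   gm of gamma that are even and odd under phi satisfy: gp x commutes with phi, gm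
   is symmetric, gm x phi = - gm x and phi (gm x) = gm x.  A 2 x 2 matrix of
   polynomials in phi is therefore an automorphism of h as soon as its values at
   phi = 1 and phi = - 1 satisfy three equations, and P and Q are found among
   these matrices. *)

Set Implicit Arguments.
Unset Strict Implicit.
Unset Printing Implicit Defensive.

Import Order.TTheory GRing.Theory Num.Theory.
Import numFieldNormedType.Exports.
Local Open Scope ring_scope.
Local Open Scope complex_scope.

Section LinearMaps.
Variable F : fieldType.

Section Rules.
Variables (U W : lmodType F) (f : U -> W) (lf : linear f).

Let Lf : {linear U -> W} := HB.pack_for {linear U -> W} f
  (GRing.isLinear.Build F U W *:%R f lf).

Lemma lin0 : f 0 = 0. Proof. exact: (linear0 Lf). Qed.
Lemma linD x y : f (x + y) = f x + f y. Proof. exact: (linearD Lf). Qed.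
Lemma linN x : f (- x) = - f x. Proof. exact: (linearN Lf). Qed.
Lemma linB x y : f (x - y) = f x - f y. Proof. exact: (linearB Lf). Qed.
Lemma linZ a x : f (a *: x) = a *: f x. Proof. exact: (linearZ_LR Lf). Qed.
Lemma lin_sum I (r : seq I) (P : pred I) (E : I -> U) :
  f (\sum_(i <- r | P i) E i) = \sum_(i <- r | P i) f (E i).
Proof. exact: (linear_sum Lf). Qed.

End Rules.

Section ScalarRules.
Variables (U : lmodType F) (f : U -> F) (lf : scalar f).

Lemma scal0 : f 0 = 0. Proof. exact: (@lin0 U F^o). Qed.
Lemma scalD x y : f (x + y) = f x + f y. Proof. exact: (@linD U F^o). Qed.
Lemma scalN x : f (- x) = - f x. Proof. exact: (@linN U F^o). Qed.
Lemma scalZ a x : f (a *: x) = a * f x. Proof. exact: (@linZ U F^o). Qed.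
Lemma scal_sum I (r : seq I) (P : pred I) (E : I -> U) :
  f (\sum_(i <- r | P i) E i) = \sum_(i <- r | P i) f (E i).
Proof. exact: (@lin_sum U F^o). Qed.

End ScalarRules.

Lemma linfunP (U W : vectType F) (f : U -> W) : linear f -> linfun f =1 f.
Proof.
move=> lf.
exact: (lfunE (HB.pack_for {linear U -> W} f
  (GRing.isLinear.Build F U W *:%R f lf))).
Qed.

Lemma linear_inj_surj (U W : vectType F) (f : U -> W) : linear f ->
  dim U = dim W -> (forall x, f x = 0 -> x = 0) -> forall y, exists x, y = f x.
Proof.
move=> lf dUW f0 y; pose h : 'Hom(U, W) := linfun f.
have hE x : h x = f x by exact: linfunP.
have kh : lker h = 0%VS.
  apply/eqP; rewrite -subv0; apply/subvP => x; rewrite memv_ker hE memv0.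
  by move=> /eqP/f0 ->.
have lh : limg h = fullv.
  apply/eqP; rewrite eqEdim subvf /= dimvf -dUW -[dim U]dimvf -(limg_ker_dim h fullv).
  by rewrite kh capv0 dimv0 add0n leqnn.
by have /memv_imgP[x _ ->] : y \in limg h by [rewrite lh memvf]; exists x.
Qed.

Definition bilin (U1 U2 W : lmodType F) (f : U1 -> U2 -> W) :=
  (forall x, linear (f x)) /\ (forall y, linear (f^~ y)).

Definition bilin_form (U1 U2 : lmodType F) (f : U1 -> U2 -> F) :=
  (forall x, scalar (f x)) /\ (forall y, scalar (f^~ y)).

Section BilinRules.
Variables (U1 U2 W : lmodType F) (f : U1 -> U2 -> W) (bf : bilin f).
Lemma bl0 y : f 0 y = 0. Proof. exact: (lin0 (bf.2 y)). Qed.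
Lemma blD x x' y : f (x + x') y = f x y + f x' y.
Proof. exact: (linD (bf.2 y)). Qed.
Lemma blN x y : f (- x) y = - f x y. Proof. exact: (linN (bf.2 y)). Qed.
Lemma blZ a x y : f (a *: x) y = a *: f x y. Proof. exact: (linZ (bf.2 y)). Qed.
Lemma br0 x : f x 0 = 0. Proof. exact: (lin0 (bf.1 x)). Qed.
Lemma brD x y y' : f x (y + y') = f x y + f x y'.
Proof. exact: (linD (bf.1 x)). Qed.
Lemma brN x y : f x (- y) = - f x y. Proof. exact: (linN (bf.1 x)). Qed.
Lemma brZ a x y : f x (a *: y) = a *: f x y. Proof. exact: (linZ (bf.1 x)). Qed.
Definition bilE := (blD, blN, blZ, brD, brN, brZ, bl0, br0).
End BilinRules.

Lemma alt_skew (U W : lmodType F) (f : U -> U -> W) :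
  bilin f -> (forall x, f x x = 0) -> forall x y, f x y = - f y x.
Proof.
move=> bf af x y; apply/eqP; rewrite -addr_eq0; apply/eqP.
by have := af (x + y); rewrite !(bilE bf) !af add0r addr0 addrC.
Qed.

Section BilinFormRules.
Variables (U1 U2 : lmodType F) (f : U1 -> U2 -> F) (bf : bilin_form f).
Lemma fl0 y : f 0 y = 0. Proof. exact: (scal0 (bf.2 y)). Qed.
Lemma flD x x' y : f (x + x') y = f x y + f x' y.
Proof. exact: (scalD (bf.2 y)). Qed.
Lemma flN x y : f (- x) y = - f x y. Proof. exact: (scalN (bf.2 y)). Qed.
Lemma flZ a x y : f (a *: x) y = a * f x y. Proof. exact: (scalZ (bf.2 y)). Qed.
Lemma fr0 x : f x 0 = 0. Proof. exact: (scal0 (bf.1 x)). Qed.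
Lemma frD x y y' : f x (y + y') = f x y + f x y'.
Proof. exact: (scalD (bf.1 x)). Qed.
Lemma frN x y : f x (- y) = - f x y. Proof. exact: (scalN (bf.1 x)). Qed.
Lemma frZ a x y : f x (a *: y) = a * f x y. Proof. exact: (scalZ (bf.1 x)). Qed.
Lemma fl_sum I (r : seq I) (P : pred I) (E : I -> U1) y :
  f (\sum_(i <- r | P i) E i) y = \sum_(i <- r | P i) f (E i) y.
Proof. exact: (scal_sum (bf.2 y)). Qed.
Definition formE := (flD, flN, flZ, frD, frN, frZ, fl0, fr0).
End BilinFormRules.

Lemma nondegenerate_repr (U : vectType F) (f : U -> U -> F) :
  bilin_form f -> nondegenerate_form f ->
  forall p : U -> F, scalar p -> exists x, forall y, f x y = p y.
Proof.
move=> bf nf p lp.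
pose h (x : U) : 'Hom(U, F^o) := linfun (f x : U -> F^o).
have hE x y : h x y = f x y by apply: (linfunP (W := F^o)); exact: bf.1.
have lh : linear h.
  by move=> a x y; apply/lfunP => z; rewrite add_lfunE scale_lfunE !hE bf.2.
have [||x hx] := linear_inj_surj lh _ _ (linfun (p : U -> F^o)).
- exact: esym (muln1 _).
- by move=> x hx; apply: nf => y; rewrite -hE hx zero_lfunE.
by exists x => y; rewrite -hE -hx (linfunP (W := F^o)).
Qed.

End LinearMaps.

Section TwoForms.
Variables (F : fieldType) (E : lmodType F).

Definition pair_vec (x y : E) : 'I_2 -> E := vcons x (fun=> y).

Lemma pair_vec0 x y : pair_vec x y ord0 = x.
Proof. by rewrite /pair_vec /vcons unlift_none. Qed.

Lemma vcons0 k (x : E) (v : 'I_k -> E) : vcons x v ord0 = x.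
Proof. by rewrite /vcons unlift_none. Qed.

Lemma vconsS k (x : E) (v : 'I_k -> E) i : vcons x v (lift ord0 i) = v i.
Proof. by rewrite /vcons liftK. Qed.

Lemma ord_max2 : ord_max = lift ord0 ord0 :> 'I_2.
Proof. exact/val_inj. Qed.

Lemma form2_vcons (f : E -> E -> F) x (v : 'I_1 -> E) :
  form2 f (vcons x v) = f x (v ord0).
Proof. by rewrite /form2 vcons0 ord_max2 vconsS. Qed.

Lemma form2P (f : E -> E -> F) :
  is_form (form2 f) <-> bilin_form f /\ (forall x, f x x = 0).
Proof.
split=> [[lf af]|[[lf1 lf2] af]]; last first.
  split=> [v i|v i j ij vij].
    case: (unliftP ord0 i) => [j|] ->{i}; last first.
      by move=> a x y; rewrite /form2 /subst /=; exact: lf2.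
    rewrite (ord1 j) -ord_max2.
    by move=> a x y; rewrite /form2 /subst /=; exact: lf1.
  rewrite /form2; case: (unliftP ord0 i) vij ij => [i'|] ->{i};
  case: (unliftP ord0 j) => [j'|] ->{j}; rewrite ?(ord1 i') ?(ord1 j') ?eqxx //.
    by rewrite ord_max2 => ->.
  by rewrite ord_max2 => ->.
split; first split.
- move=> x a y z; have := lf (pair_vec x x) ord_max a y z.
  by rewrite /form2 /subst /= pair_vec0.
- move=> y a x z; have := lf (pair_vec x y) ord0 a x z.
  by rewrite /form2 /subst /= ord_max2 /pair_vec vconsS.
- move=> x; have := af (pair_vec x x) ord0 ord_max isT.
  by rewrite form2_vcons; apply; rewrite ord_max2 /pair_vec vconsS vcons0.
Qed.

Lemma skew_alt (f : E -> E -> F) : bilin_form f -> (forall x, f x x = 0) ->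
  forall x y, f x y = - f y x.
Proof. exact: (@alt_skew F E F^o). Qed.

Lemma ce_d_form2 (br : E -> E -> E) (f : E -> E -> F) v :
  ce_d br (form2 f) v =
  - f (br (v ord0) (v (lift ord0 ord0))) (v ord_max)
  + f (br (v ord0) (v ord_max)) (v (lift ord0 ord0))
  - f (br (v (lift ord0 ord0)) (v ord_max)) (v ord0).
Proof.
have vE i : v i = nth 0 [:: v ord0; v (lift ord0 ord0); v ord_max] i.
  by case: i => [[|[|[|//]]] lti] /=; congr v; apply: val_inj.
rewrite /ce_d big_ord_recl big_ord_recl big_ord1 [X in X + _]big_mkcond.
rewrite [X in _ + (X + _)]big_mkcond [X in _ + (_ + X)]big_mkcond.
rewrite !big_ord_recl !big_ord0 /= !form2_vcons /= !addr0 !add0r.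
move: (v ord0) (v (lift ord0 ord0)) (v ord_max) vE => v0 v1 v2 vE.
rewrite !vE /= /bump /= !addn0 !add0n !exprS expr0.
by rewrite !mulr1 !mulN1r !opprK !mul1r mulN1r.
Qed.

Definition vec3 (x y z : E) : 'I_3 -> E := vcons x (pair_vec y z).

Lemma closed_2formP (br : E -> E -> E) (f : E -> E -> F) :
  bilin br -> (forall x, br x x = 0) ->
  closed_2form br f <-> [/\ bilin_form f, forall x, f x x = 0 &
    forall x y z, f (br x y) z + f (br y z) x + f (br z x) y = 0].
Proof.
move=> bbr abr.
have kbr := alt_skew bbr abr.
rewrite /closed_2form form2P; split=> [[[bf af] cf]|[bf af cf]]; split=> //.
  move=> x y z; have := cf (vec3 x y z).
  have o2 : ord_max = lift ord0 (lift ord0 ord0) :> 'I_3 by exact/val_inj.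
  rewrite ce_d_form2 o2 /vec3 /pair_vec !vconsS !vcons0 => /eqP.
  rewrite -oppr_eq0 !opprD !opprK (kbr z x) (flN bf) => /eqP <-.
  by rewrite addrAC.
move=> v; rewrite ce_d_form2; apply/eqP.
rewrite -oppr_eq0 !opprD !opprK.
rewrite -[X in _ == X](cf (v ord0) (v (lift ord0 ord0)) (v ord_max)).
by rewrite (kbr (v ord_max)) (flN bf) addrAC.
Qed.

End TwoForms.

Section Complexify.
Variable R : rcfType.

Lemma complex_eq (a b : R[i]) :
  complex.Re a = complex.Re b -> complex.Im a = complex.Im b -> a = b.
Proof. by case: a b => [a a'] [b b'] /= -> ->. Qed.

Lemma cplx_eq (V : lmodType R) (X Y : cplx V) :
  X.1 = Y.1 -> X.2 = Y.2 -> X = Y.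
Proof. by case: X Y => [a a'] [b b'] /= -> ->. Qed.

Definition frame_map (U V : lmodType R) (n1 n2 : U -> V) (X : cplx U) : cplx V :=
  (n1 X.1 - n2 X.2, n1 X.2 + n2 X.1).

Lemma frame_map_linear (U V : lmodType R) (n1 n2 : U -> V) :
  linear n1 -> linear n2 -> linear (frame_map n1 n2).
Proof.
move=> l1 l2 [a a'] [x x'] [y y']; apply: cplx_eq => /=.
  rewrite !(linD l1, linD l2, linN l1, linN l2, linZ l1, linZ l2).
  by rewrite !scalerDr !scalerN !opprD addrACA [X in X + _]addrACA -opprD.
rewrite !(linD l1, linD l2, linN l1, linN l2, linZ l1, linZ l2).
by rewrite !scalerDr !scalerN addrACA [X in X + _]addrACA.
Qed.

Lemma cmap_linear (U W : lmodType R) (f : U -> W) : linear f ->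
  linear (cmap f : cplx U -> cplx W).
Proof.
move=> lf [a a'] [x x'] [y y']; apply: cplx_eq => /=.
  by rewrite !(linD lf) (linN lf) !(linZ lf).
by rewrite !(linD lf) !(linZ lf).
Qed.

Lemma cpair_bilin (V : lmodType R) (f : V -> V -> R) :
  bilin_form f -> bilin_form (cpair f).
Proof.
move=> bf; split=> [Z [a a'] X Y|Z [a a'] X Y];
  apply: complex_eq; rewrite /= !(formE bf); ring.
Qed.

Lemma cpair_nondegenerate (V : lmodType R) (f : V -> V -> R) :
  bilin_form f -> nondegenerate_form f -> nondegenerate_form (cpair f).
Proof.
move=> bf nf X hX.
have hx y : f X.1 y = 0 /\ f X.2 y = 0.
  have := hX (y, 0); rewrite /cpair /= !(fr0 bf) subr0 add0r.
  by move=> /eqP; rewrite eq_complex /= => /andP[/eqP -> /eqP ->].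
by apply: cplx_eq; apply: nf => y; have [] := hx y.
Qed.

Lemma cpair_cbil_cyclic (V : lmodType R) (b : V -> V -> V) (f : V -> V -> R) :
  bilin_form f ->
  (forall x y z, f (b x y) z + f (b y z) x + f (b z x) y = 0) ->
  forall X Y Z, cpair f (cbil b X Y) Z + cpair f (cbil b Y Z) X +
    cpair f (cbil b Z X) Y = 0.
Proof.
move=> bf hf [x x'] [y y'] [z z']; apply: complex_eq; rewrite /= !(formE bf).
  have := hf x y z; have := hf x' y' z; have := hf x y' z'; have := hf x' y z'.
  by lra.
have := hf x y z'; have := hf x' y z; have := hf x y' z; have := hf x' y' z'.
by lra.
Qed.

Lemma cbil_bilin (V : lmodType R) (b : V -> V -> V) :
  bilin b -> bilin (cbil b : cplx V -> cplx V -> cplx V).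
Proof.
move=> [br bl]; split=> [X|Y]; first exact: frame_map_linear (br X.1) (br X.2).
have cE X : cbil b X Y = frame_map (b^~ Y.1) (b^~ Y.2) X.
  by rewrite /cbil /frame_map [X in (_, X)]addrC.
by move=> a X X'; rewrite !cE; exact: frame_map_linear (bl Y.1) (bl Y.2) _ _ _.
Qed.

Lemma cpair_alt (V : lmodType R) (f : V -> V -> R) :
  bilin_form f -> (forall x, f x x = 0) -> forall X : cplx V, cpair f X X = 0.
Proof.
move=> bf af [x x']; apply: complex_eq; rewrite /= ?af ?subrr //.
by rewrite (skew_alt bf af x) addNr.
Qed.

Lemma cbil_alt (V : lmodType R) (b : V -> V -> V) :
  bilin b -> (forall x, b x x = 0) -> forall X : cplx V, cbil b X X = 0.
Proof.
move=> bb ab [x x']; apply: cplx_eq; rewrite /= ?ab ?subrr //.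
by have := ab (x + x'); rewrite !(bilE bb) !ab add0r addr0 addrC.
Qed.

End Complexify.

Section Dorfman.
Variables (R : realType) (h : vectType R) (br : h -> h -> h).
Hypothesis bbr : bilin br.
Local Notation dual := 'Hom(h, R^o).
Local Notation dbl := (h * dual)%type.

Lemma int_prodE (f : h -> h -> R) : bilin_form f -> forall x y, int_prod f x y = f x y.
Proof. by move=> bf x y; rewrite /int_prod (linfunP (W := R^o)) //; exact: bf.1. Qed.

Lemma int_prod_linear (f : h -> h -> R) : bilin_form f -> linear (int_prod f).
Proof.
move=> bf a x y; apply/lfunP => z.
by rewrite add_lfunE scale_lfunE !int_prodE // bf.2.
Qed.

Lemma lie_derE (x : h) (b : dual) z : lie_der br x b z = - b (br x z).
Proof.
rewrite /lie_der (linfunP (W := R^o)) // => a y y'.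
by rewrite (brD bbr) (brZ bbr) linearD linearZ opprD scalerN.
Qed.

Lemma lie_der_bilin : bilin (lie_der br).
Proof.
split=> [x a b c|b a x y]; apply/lfunP => z; rewrite add_lfunE scale_lfunE !lie_derE.
  by rewrite add_lfunE scale_lfunE opprD scalerN.
by rewrite (blD bbr) (blZ bbr) linearD linearZ opprD scalerN.
Qed.

Lemma dorfman_bilin : bilin (dorfman br).
Proof.
split=> [e a f f'|f a e e']; congr pair => /=; first exact: bbr.1; last 2 first.
- exact: bbr.2.
- by rewrite !(bilE lie_der_bilin) scalerBr opprD addrACA.
- by rewrite !(bilE lie_der_bilin) scalerBr opprD addrACA.
Qed.

Lemma pairing_bilin : bilin_form (@pairing R h).
Proof.
split=> [e a f f'|f a e e']; rewrite /pairing /= !linearD !linearZ /=;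
  rewrite !add_lfunE !scale_lfunE /= /GRing.scale /=; ring.
Qed.

Lemma pairingC (e f : dbl) : pairing e f = pairing f e.
Proof. by rewrite /pairing addrC. Qed.

End Dorfman.

Lemma mem_span_map (K : fieldType) (U W : vectType K) (L : {vspace U})
    (f : U -> W) (H : vectType K) (N : H -> U) (D : H -> W) :
  linear N -> linear D -> (forall X, N X = 0 -> X = 0) ->
  (forall l, l \in L <-> exists X, l = N X) -> (forall X, f (N X) = D X) ->
  forall l, l \in <<[seq f u | u <- vbasis L]>>%VS <-> exists X, l = D X.
Proof.
move=> lN lD N0 LN fN l; split.
  have sD : (<<[seq f u | u <- vbasis L]>> <= limg (linfun D))%VS.
    apply/span_subvP => _ /mapP[u /vbasis_mem uL ->].
    have [X ->] := (LN u).1 uL.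
    by rewrite fN -(linfunP lD) memv_img // memvf.
  by move=> /(subvP sD)/memv_imgP[X _ ->]; exists X; rewrite (linfunP lD).
move=> [X ->]; pose e := vbasis L.
have eN (i : 'I_(\dim L)) : exists Y, e`_i = N Y.
  by apply: (LN _).1; apply: vbasis_mem; exact: memt_nth.
have {eN} [Y hY] := fin_all_exists eN.
have XL : N X \in L by apply/LN; exists X.
have -> : X = \sum_i coord e i (N X) *: Y i.
  apply/eqP; rewrite -subr_eq0; apply/eqP/N0.
  rewrite (linB lN) (lin_sum lN) {1}(coord_vbasis XL) -sumrB big1 // => i _.
  by rewrite (linZ lN) -hY subrr.
rewrite (lin_sum lD) memv_suml // => i _; rewrite (linZ lD) memvZ //.
by rewrite -fN -hY; apply/memv_span/map_f/memt_nth.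
Qed.

Section Conjugation.
Variables (R : realType) (V : vectType R).

Lemma cconjK : involutive (@cconj R V).
Proof. by case=> x y; rewrite /cconj /= opprK. Qed.

Lemma cconjZD (a : R[i]) (X Y : cplx V) :
  cconj (a *: X + Y) = a^*%C *: cconj X + cconj Y.
Proof.
case: a X Y => [a a'] [x x'] [y y']; apply: cplx_eq => /=.
  by rewrite scalerN scaleNr opprK.
by rewrite scalerN scaleNr !opprD.
Qed.

Lemma cconj_sum I (r : seq I) (a : I -> R[i]) (X : I -> cplx V) :
  cconj (\sum_(i <- r) a i *: X i) = \sum_(i <- r) (a i)^*%C *: cconj (X i).
Proof.
elim: r => [|i r IH]; last by rewrite !big_cons cconjZD IH.
by rewrite !big_nil; apply: cplx_eq => /=; rewrite ?oppr0.
Qed.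

End Conjugation.

Lemma mem_conj_space (R : realType) (h : vectType R)
    (L : {vspace cplx (h * 'Hom(h, R^o))%type}) l :
  l \in conj_space L <-> cconj l \in L.
Proof.
split=> [lL|lL].
  rewrite (coord_span (X := in_tuple _) lL) cconj_sum memv_suml // => i _.
  rewrite memvZ // (nth_map 0) ?cconjK ?vbasis_mem ?mem_nth //;
  by have := ltn_ord i; rewrite [X in (_ < X)%N]size_map.
rewrite -[l]cconjK (coord_vbasis lL) cconj_sum memv_suml // => i _.
by rewrite memvZ //; apply/memv_span/map_f/memt_nth.
Qed.

Section Frames.
Variables (R : realType) (h : vectType R) (br : h -> h -> h).
Hypothesis bbr : bilin br.
Local Notation dual := 'Hom(h, R^o).
Local Notation dbl := (h * dual)%type.
Local Notation cdbl := (cplx dbl).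

(* [n1 + i n2] parametrizes a generalized complex structure by the complexified
   Lie algebra and [n1 - i n2] its conjugate. *)
Record real_frame (n1 n2 : h -> dbl) (Om : h -> h -> R) : Prop := RealFrame {
  rf_lin1 : linear n1;
  rf_lin2 : linear n2;
  rf_br1 : forall x y,
    dorfman br (n1 x) (n1 y) - dorfman br (n2 x) (n2 y) = n1 (br x y);
  rf_br2 : forall x y,
    dorfman br (n1 x) (n2 y) + dorfman br (n2 x) (n1 y) = n2 (br x y);
  rf_pair11 : forall x y, pairing (n1 x) (n1 y) = 0;
  rf_pair22 : forall x y, pairing (n2 x) (n2 y) = 0;
  rf_pair12 : forall x y, pairing (n1 x) (n2 y) = 2^-1 * Om x y;
  rf_skew : forall x y, Om x y = - Om y x;
  rf_nondeg : nondegenerate_form Om }.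

(* [N] and [M] parametrize [L] and its conjugate by one and the same Lie algebra.
   As the DGA of [L] is made of the bracket of [L] and of the differential dual to
   the bracket of the conjugate, it only depends on [bH] and on [Th]. *)
Record gcs_frame (L : {vspace cdbl}) (H : vectType R[i]) (bH : H -> H -> H)
    (Th : H -> H -> R[i]) (N M : H -> cdbl) : Prop := GcsFrame {
  gf_linN : linear N;
  gf_linM : linear M;
  gf_N : forall l, l \in L <-> exists X, l = N X;
  gf_M : forall l, l \in conj_space L <-> exists X, l = M X;
  gf_brN : forall X Y, cbracket br (N X) (N Y) = N (bH X Y);
  gf_brM : forall X Y, cbracket br (M X) (M Y) = M (bH X Y);
  gf_pair : forall X Y, 2 * cpairing (N X) (M Y) = Th X Y;
  gf_nondegl : forall X, (forall Y, Th X Y = 0) -> X = 0;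
  gf_nondegr : forall Y, (forall X, Th X Y = 0) -> Y = 0 }.

Section RealFrameTheory.
Variables (n1 n2 : h -> dbl) (Om : h -> h -> R).
Hypothesis rf : real_frame n1 n2 Om.

Let l1 := rf_lin1 rf.
Let l2 := rf_lin2 rf.
Let bd := dorfman_bilin bbr.
Let bp := @pairing_bilin R h.

Lemma rf_pair21 x y : pairing (n2 x) (n1 y) = - (2^-1 * Om x y).
Proof. by rewrite pairingC (rf_pair12 rf) (rf_skew rf) mulrN. Qed.

Lemma rf_bilin : bilin_form Om.
Proof.
have OmE x y : Om x y = 2 * pairing (n1 x) (n2 y).
  by rewrite (rf_pair12 rf) mulrA divff ?mul1r // pnatr_eq0.
split=> [x a y z|y a x z]; rewrite !OmE ?(linD l1, linD l2, linZ l1, linZ l2).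
  by rewrite (frD bp) (frZ bp); ring.
by rewrite (flD bp) (flZ bp); ring.
Qed.

Lemma rf_linear2N : linear (fun x => - n2 x).
Proof. by move=> a x y; rewrite l2 opprD scalerN. Qed.

Lemma real_frame_conj X :
  cconj (frame_map n1 n2 X) = frame_map n1 (fun x => - n2 x) (cconj X).
Proof.
apply: cplx_eq; rewrite /= ?(linN l1) ?(linN l2) ?opprK // opprD addrC.
by rewrite addrC.
Qed.

Lemma real_frame_bracket X Y :
  cbracket br (frame_map n1 n2 X) (frame_map n1 n2 Y) =
  frame_map n1 n2 (cbil br X Y).
Proof.
case: X Y => [x x'] [y y']; apply: cplx_eq;
  rewrite /= !(linD l1, linD l2, linN l1, linN l2) -!(rf_br1 rf) -!(rf_br2 rf).
  rewrite !(bilE bd) ?opprD ?opprK !addrA.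
  by rewrite [LHS](ACl (1*8*5*4*2*7*6*3)).
rewrite !(bilE bd) ?opprD ?opprK !addrA.
by rewrite [LHS](ACl (1*8*5*4*2*7*6*3)).
Qed.

Lemma real_frame_isotropic X Y :
  cpairing (frame_map n1 n2 X) (frame_map n1 n2 Y) = 0.
Proof.
apply: complex_eq; rewrite /= !(formE bp) !(rf_pair11 rf) !(rf_pair22 rf).
  by rewrite !rf_pair21 !(rf_pair12 rf); ring.
by rewrite !rf_pair21 !(rf_pair12 rf); ring.
Qed.

Lemma real_frame_pairing X Y :
  2 * cpairing (frame_map n1 n2 X) (frame_map n1 (fun x => - n2 x) Y) =
  (0 +i* (- 2)) * cpair Om X Y.
Proof.
apply: complex_eq; rewrite /= !(formE bp) !(rf_pair11 rf) !(rf_pair22 rf).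
  by rewrite !rf_pair21 !(rf_pair12 rf); field.
by rewrite !rf_pair21 !(rf_pair12 rf); field.
Qed.

Lemma real_frame_conj_space (L : {vspace cdbl}) :
  (forall l, l \in L <-> exists X, l = frame_map n1 n2 X) ->
  forall l, l \in conj_space L <->
    exists X, l = frame_map n1 (fun x => - n2 x) X.
Proof.
move=> LN l; rewrite mem_conj_space LN; split=> [][X lX].
  by exists (cconj X); rewrite -real_frame_conj -lX cconjK.
by exists (cconj X); rewrite lX -[X in frame_map _ _ X]cconjK -real_frame_conj cconjK.
Qed.

Lemma real_frame_surj (e : dbl) : exists x y, e = n1 x + n2 y.
Proof.
have lf : linear (fun z : h * h => n1 z.1 + n2 z.2).
  by move=> a z z'; rewrite /= l1 l2 scalerDr addrACA.
have [||[x y] ->] := linear_inj_surj lf _ _ e; last by exists x, y.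
  by rewrite -[LHS]/(dim h + dim h)%N -[RHS]/(dim h + dim h * 1)%N muln1.
have half0 (a : R) : 2^-1 * a = 0 -> a = 0.
  by move=> /eqP; rewrite mulf_eq0 invr_eq0 pnatr_eq0 /= => /eqP.
move=> [x y] /= exy; congr pair; apply: (rf_nondeg rf) => z; apply: half0.
  rewrite -(rf_pair12 rf) -[LHS]addr0 -[X in _ + X = _](rf_pair22 rf y z).
  by rewrite -(flD bp) exy (fl0 bp).
apply/eqP; rewrite -oppr_eq0 -rf_pair21 -[X in X == _]add0r.
rewrite -[X in X + _ == _](rf_pair11 rf x z).
by rewrite -(flD bp) exy (fl0 bp).
Qed.

Lemma real_frame_gcs (L : {vspace cdbl}) :
  (forall l, l \in L <-> exists X, l = frame_map n1 n2 X) -> is_gcs br L.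
Proof.
move=> LN; split.
- by move=> l m /LN[X ->] /LN[Y ->]; exact: real_frame_isotropic.
- move=> L' iL' sLL'; apply/eqP; rewrite eqEsubv sLL' andbT.
  apply/subvP => l lL'; apply/LN.
  have [x [y e1]] := real_frame_surj l.1.
  have [x' [y' e2]] := real_frame_surj l.2.
  have hz z : Om (x' + y) z = 0 /\ Om (x - y') z = 0.
    have zL : frame_map n1 n2 (z, 0) \in L' by apply/(subvP sLL')/LN; exists (z, 0).
    move/eqP: (iL' _ _ lL' zL); rewrite eq_complex /= e1 e2.
    rewrite (lin0 l1) (lin0 l2) subr0 add0r !(formE bp) !(rf_pair11 rf).
    rewrite !(rf_pair22 rf) !rf_pair21 !(rf_pair12 rf) !(formE rf_bilin).
    by move=> /andP[/eqP re /eqP im]; split; lra.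
  have x'E : x' = - y.
    apply/eqP; rewrite -addr_eq0; by apply/eqP/(rf_nondeg rf) => z; case: (hz z).
  have y'E : x = y'.
    apply/eqP; rewrite -subr_eq0; by apply/eqP/(rf_nondeg rf) => z; case: (hz z).
  exists (x, - y); apply: cplx_eq; rewrite /= ?e1 ?e2 ?x'E -?y'E //.
  by rewrite (linN l2) opprK.
- by move=> l m /LN[X ->] /LN[Y ->]; apply/LN; exists (cbil br X Y);
    exact: real_frame_bracket.
apply/eqP; rewrite -subv0; apply/subvP => l; rewrite memv_cap memv0.
move=> /andP[/LN[X ->] /(real_frame_conj_space LN)[Y XY]].
suff Y0 : Y = 0 by rewrite XY Y0 (lin0 (frame_map_linear l1 rf_linear2N)).
have nY Z : cpair Om Z Y = 0.
  have := real_frame_pairing Z Y; rewrite -XY real_frame_isotropic mulr0.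
  move=> /esym/eqP; rewrite mulf_eq0 => /orP[|/eqP //].
  by rewrite eq_complex /= oppr_eq0 pnatr_eq0 andbF.
apply: (cpair_nondegenerate rf_bilin (rf_nondeg rf)) => Z.
rewrite -[RHS]oppr0 -(nY Z); apply: complex_eq;
  rewrite /= !(rf_skew rf Z.1) !(rf_skew rf Z.2); ring.
Qed.

Lemma real_frame_opp : real_frame n1 (fun x => - n2 x) (fun x y => - Om x y).
Proof.
split=> //; first exact: rf_linear2N.
- by move=> x y; rewrite (blN bd) (brN bd) opprK (rf_br1 rf).
- by move=> x y; rewrite (blN bd) (brN bd) -opprD (rf_br2 rf).
- exact: (rf_pair11 rf).
- by move=> x y; rewrite (flN bp) (frN bp) opprK (rf_pair22 rf).
- by move=> x y; rewrite (frN bp) (rf_pair12 rf) mulrN.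
- by move=> x y; rewrite (rf_skew rf).
move=> x xy; apply: (rf_nondeg rf) => y; apply/eqP; rewrite -oppr_eq0; apply/eqP.
exact: xy.
Qed.

End RealFrameTheory.

Lemma real_frame_frame n1 n2 Om (L : {vspace cdbl}) :
  real_frame n1 n2 Om ->
  (forall l, l \in L <-> exists X, l = frame_map n1 n2 X) ->
  gcs_frame L (cbil br) (fun X Y => (0 +i* (- 2)) * cpair Om X Y)
    (frame_map n1 n2) (frame_map n1 (fun x => - n2 x)).
Proof.
have n0 (c : R[i]) : (0 +i* (- 2)) * c = 0 -> c = 0.
  move=> /eqP; rewrite mulf_eq0 => /orP[|/eqP //].
  by rewrite eq_complex /= oppr_eq0 pnatr_eq0 andbF.
move=> rf LN; split=> //.
- exact: frame_map_linear (rf_lin1 rf) (rf_lin2 rf).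
- exact: frame_map_linear (rf_lin1 rf) (rf_linear2N rf).
- exact (real_frame_conj_space rf LN).
- exact: real_frame_bracket rf.
- exact: real_frame_bracket (real_frame_opp rf).
- exact: real_frame_pairing rf.
- move=> X nX; apply: (cpair_nondegenerate (rf_bilin rf) (rf_nondeg rf)) => Y.
  exact/n0/nX.
move=> X nX; apply: (cpair_nondegenerate (rf_bilin rf) (rf_nondeg rf)) => Y.
rewrite -[RHS]oppr0 -(n0 _ (nX Y)); apply: complex_eq;
  rewrite /= !(rf_skew rf X.1) !(rf_skew rf X.2); ring.
Qed.

Lemma gcs_frame_comp (L : {vspace cdbl}) (H : vectType R[i]) (bH : H -> H -> H)
    (Th Th' : H -> H -> R[i]) (N M : H -> cdbl) (P Q : H -> H) :
  gcs_frame L bH Th N M ->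
  linear P -> (forall X Y, P (bH X Y) = bH (P X) (P Y)) ->
  linear Q -> (forall X Y, Q (bH X Y) = bH (Q X) (Q Y)) ->
  (forall X Y, Th (P X) (Q Y) = Th' X Y) ->
  (forall X, (forall Y, Th' X Y = 0) -> X = 0) ->
  (forall Y, (forall X, Th' X Y = 0) -> Y = 0) ->
  gcs_frame L bH Th' (N \o P) (M \o Q).
Proof.
move=> fr lP mP lQ mQ ThPQ nl nr.
have bp := cpair_bilin (@pairing_bilin R h).
have [lN lM LN LM brN brM pr _ _] := fr.
have Sl x y : linear x -> linear y -> linear (x \o y : H -> cdbl).
  by move=> lx ly a z z'; rewrite /= ly lx.
have sP y : exists x, y = P x.
  apply: linear_inj_surj => // x Px; apply: nl => Y.
  by rewrite -ThPQ Px -pr (lin0 lN) /cpairing (fl0 bp) mulr0.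
have sQ y : exists x, y = Q x.
  apply: linear_inj_surj => // x Px; apply: nr => Y.
  by rewrite -ThPQ Px -pr (lin0 lM) /cpairing (fr0 bp) mulr0.
split=> /=; [exact: Sl | exact: Sl | | | | | | exact: nl | exact: nr].
- move=> l; rewrite LN; split=> [][X ->]; last by exists (P X).
  by have [Y ->] := sP X; exists Y.
- move=> l; rewrite LM; split=> [][X ->]; last by exists (Q X).
  by have [Y ->] := sQ X; exists Y.
- by move=> X Y; rewrite brN mP.
- by move=> X Y; rewrite brM mQ.
- by move=> X Y; rewrite pr ThPQ.
Qed.
End Frames.

Section WedgeLinear.
Variables (F : fieldType) (E : lmodType F) (I : finType) (c : I -> F).

Lemma wedge_suml p q (A : I -> Defs.form E p) (B : Defs.form E q) v :
  wedge (fun u => \sum_i c i * A i u) B v = \sum_i c i * wedge (A i) B v.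
Proof.
rewrite /wedge; under [RHS]eq_bigr do rewrite mulrCA mulr_sumr.
rewrite -mulr_sumr exchange_big; congr (_ * _); apply: eq_bigr => s _ /=.
rewrite mulr_suml mulr_sumr; apply: eq_bigr => i _.
by rewrite -mulrA mulrCA.
Qed.

Lemma wedge_sumr p q (A : Defs.form E p) (B : I -> Defs.form E q) v :
  wedge A (fun u => \sum_i c i * B i u) v = \sum_i c i * wedge A (B i) v.
Proof.
rewrite /wedge; under [RHS]eq_bigr do rewrite mulrCA mulr_sumr.
rewrite -mulr_sumr exchange_big; congr (_ * _); apply: eq_bigr => s _ /=.
rewrite !mulr_sumr; apply: eq_bigr => i _.
by rewrite [A _ * (_ * _)]mulrCA [LHS]mulrCA.
Qed.

End WedgeLinear.

Section Pullback.
Variables (F : fieldType) (E E' : lmodType F) (psi : E -> E').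

Definition pull k (a : Defs.form E' k) : Defs.form E k := fun v => a (psi \o v).

Lemma comp_vcons k u (v : 'I_k -> E) :
  psi \o vcons u v = vcons (psi u) (psi \o v).
Proof. by apply/funext => i; rewrite /vcons /=; case: unlift. Qed.

Lemma comp_subst k (v : 'I_k -> E) i u :
  psi \o subst v i u = subst (psi \o v) i (psi u).
Proof. by apply/funext => j; rewrite /subst /=; case: eqP. Qed.

Lemma pull_is_form k (a : Defs.form E' k) : linear psi -> is_form a -> is_form (pull a).
Proof.
move=> lp [la aa]; split=> [v i b x y|v i j ij vij].
  by rewrite /pull !comp_subst lp la.
by apply: (aa _ i j) => //=; rewrite vij.
Qed.

Lemma pull_ce_d (b : E -> E -> E) (b' : E' -> E' -> E') k (a : Defs.form E' k) :
  (forall x y, psi (b x y) = b' (psi x) (psi y)) ->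
  pull (ce_d b' a) = ce_d b (pull a).
Proof.
move=> bb'; case: k a => [//|k] a; apply/funext => v; rewrite /pull /ce_d.
apply: eq_bigr => i _; apply: eq_bigr => j _.
by rewrite comp_vcons bb'.
Qed.

End Pullback.

Lemma is_form_contract_lin (F : fieldType) (E : lmodType F) k (a : Defs.form E k.+1) v :
  is_form a -> scalar (fun u => a (vcons u v)).
Proof.
case=> la _ b x y; have := la (vcons 0 v) ord0 b x y.
have sE u : subst (vcons 0 v) ord0 u = vcons u v.
  apply/funext => j; rewrite /subst /vcons; case: unliftP => [j'|] -> //.
by rewrite !sE.
Qed.

Section FrameDGA.
Variables (R : realType) (h : vectType R) (br : h -> h -> h).
Local Notation dual := 'Hom(h, R^o).
Local Notation dbl := (h * dual)%type.
Local Notation cdbl := (cplx dbl).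
Variables (L : {vspace cdbl}) (H : vectType R[i]) (bH : H -> H -> H).
Variables (Th : H -> H -> R[i]) (N M : H -> cdbl).
Hypothesis fr : gcs_frame br L bH Th N M.
Hypothesis bbH : bilin bH.

Let bp := cpair_bilin (@pairing_bilin R h).

Lemma gf_bilin : bilin_form Th.
Proof.
split=> [X a Y Z|Y a X Z]; rewrite -!(gf_pair fr).
  by rewrite (gf_linM fr) /cpairing (frD bp) (frZ bp) mulrDr mulrCA.
by rewrite (gf_linN fr) /cpairing (flD bp) (flZ bp) mulrDr mulrCA.
Qed.

Lemma gf_N0 X : N X = 0 -> X = 0.
Proof.
move=> NX; apply: (gf_nondegl fr) => Y.
by rewrite -(gf_pair fr) NX /cpairing (fl0 bp) mulr0.
Qed.

Lemma gf_M0 X : M X = 0 -> X = 0.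
Proof.
move=> MX; apply: (gf_nondegr fr) => Y.
by rewrite -(gf_pair fr) MX /cpairing (fr0 bp) mulr0.
Qed.

Definition bar_of (X : H) : lbar L := vsproj (conj_space L) (M X).
Definition of_bar (b : lbar L) : H := ((linfun M)^-1)%VF (vsval b).

Lemma M_conj X : M X \in conj_space L.
Proof. by apply/(gf_M fr); exists X. Qed.

Lemma val_bar_of X : vsval (bar_of X) = M X.
Proof. exact/vsprojK/M_conj. Qed.

Lemma M_of_bar b : M (of_bar b) = vsval b.
Proof.
have [X bX] := (gf_M fr (vsval b)).1 (subvsP b).
rewrite -(linfunP (gf_linM fr)) limg_lfunVK // bX -(linfunP (gf_linM fr)).
by rewrite memv_img // memvf.
Qed.

Lemma of_barK : cancel of_bar bar_of.
Proof. by move=> b; apply: val_inj; rewrite /= val_bar_of M_of_bar. Qed.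

Lemma bar_ofK : cancel bar_of of_bar.
Proof.
move=> X; apply/eqP; rewrite -subr_eq0; apply/eqP/gf_M0.
by rewrite (linB (gf_linM fr)) M_of_bar val_bar_of subrr.
Qed.

Lemma bar_of_linear : linear bar_of.
Proof. by move=> a X Y; rewrite /bar_of (gf_linM fr) linearP. Qed.

Lemma of_bar_linear : linear of_bar.
Proof. by move=> a X Y; rewrite /of_bar /= !linearP. Qed.

Lemma flat_N X b : flat (N X) b = Th X (of_bar b).
Proof. by rewrite /flat -M_of_bar (gf_pair fr). Qed.

Lemma sharp_eq p X : (forall Y, Th X Y = p (bar_of Y)) -> sharp p = N X.
Proof.
move=> hX; apply: xget_unique => [|_ [/(gf_N fr)[Y ->] hY]].
  split=> [|b]; first by apply/(gf_N fr); exists X.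
  by rewrite flat_N hX of_barK.
congr N; apply/eqP; rewrite -subr_eq0; apply/eqP/(gf_nondegl fr) => Z.
rewrite (flD gf_bilin) (flN gf_bilin) hX -hY flat_N bar_ofK subrr //.
Qed.

Lemma sharp_ex p : scalar p -> exists X, forall Y, Th X Y = p (bar_of Y).
Proof.
move=> lp; apply: (nondegenerate_repr gf_bilin (gf_nondegl fr)).
by move=> a X Y; rewrite bar_of_linear lp.
Qed.

Lemma lbar_bracketE a b :
  lbar_bracket br a b = bar_of (bH (of_bar a) (of_bar b)).
Proof. by rewrite /lbar_bracket /bar_of -(gf_brM fr) !M_of_bar. Qed.

Lemma schoutenE p q (P : multivector L p.+1) (Q : multivector L q.+1)
    (e := vbasis (fullv : {vspace lbar L})) (X : 'I_(\dim {:lbar L}) -> H) v :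
  (forall i Y, Th (X i) Y = coord e i (bar_of Y)) ->
  schouten br P Q v = \sum_i \sum_j
    wedge (wedge (form1 (fun b => Th (bH (X i) (X j)) (of_bar b)))
      (Defs.contract e`_i P)) (Defs.contract e`_j Q) v.
Proof.
move=> hX; have sX i : sharp (coord e i) = N (X i) by exact: sharp_eq (hX i).
apply: eq_bigr => i _; apply: eq_bigr => j _; rewrite !sX (gf_brN fr).
congr (wedge (wedge (form1 _) _) _ v).
by apply/funext => b; rewrite flat_N.
Qed.

End FrameDGA.

Section FrameIso.
Variables (R : realType) (h : vectType R) (br : h -> h -> h).
Local Notation cdbl := (cplx (h * 'Hom(h, R^o))%type).
Variables (L1 L2 : {vspace cdbl}) (H : vectType R[i]) (bH : H -> H -> H).
Variables (Th : H -> H -> R[i]) (N1 M1 N2 M2 : H -> cdbl).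
Hypotheses (bbH : bilin bH).
Hypotheses (f1 : gcs_frame br L1 bH Th N1 M1) (f2 : gcs_frame br L2 bH Th N2 M2).

Let psi (b : lbar L2) : lbar L1 := bar_of L1 M1 (of_bar M2 b).
Let psi' (b : lbar L1) : lbar L2 := bar_of L2 M2 (of_bar M1 b).

Let psiK : cancel psi psi'.
Proof. by move=> b; rewrite /psi /psi' (bar_ofK f1) (of_barK f2). Qed.
Let psi'K : cancel psi' psi.
Proof. by move=> b; rewrite /psi /psi' (bar_ofK f2) (of_barK f1). Qed.

Let psi_linear : linear psi.
Proof. by move=> a x y; rewrite /psi of_bar_linear (bar_of_linear f1). Qed.
Let psi'_linear : linear psi'.
Proof. by move=> a x y; rewrite /psi' of_bar_linear (bar_of_linear f2). Qed.

Lemma frame_iso_schouten p q (P : multivector L1 p.+1) (Q : multivector L1 q.+1) :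
  is_form P -> is_form Q ->
  pull psi (schouten br P Q) = schouten br (pull psi P) (pull psi Q).
Proof.
move=> fP fQ; apply/funext => v; rewrite /pull.
pose e1 := vbasis (fullv : {vspace lbar L1}).
pose e2 := vbasis (fullv : {vspace lbar L2}).
have ex1 i : exists X, forall Y, Th X Y = coord e1 i (bar_of L1 M1 Y).
  by apply: (sharp_ex f1) => a x y; rewrite linearP.
have ex2 i : exists X, forall Y, Th X Y = coord e2 i (bar_of L2 M2 Y).
  by apply: (sharp_ex f2) => a x y; rewrite linearP.
have [X1 hX1] := fin_all_exists ex1; have [X2 hX2] := fin_all_exists ex2.
rewrite (schoutenE f1 _ _ _ hX1) (schoutenE f2 _ _ _ hX2).
pose c (i : 'I_(\dim {:lbar L2})) (k : 'I_(\dim {:lbar L1})) : R[i] :=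
  coord e1 k (psi e2`_i).
have X1E k : X1 k = \sum_i c i k *: X2 i.
  apply/eqP; rewrite -subr_eq0; apply/eqP/(gf_nondegl f1) => Y.
  rewrite (flD (gf_bilin f1)) (flN (gf_bilin f1)) (fl_sum (gf_bilin f1)) hX1.
  have -> : bar_of L1 M1 Y = psi (bar_of L2 M2 Y) by rewrite /psi (bar_ofK f2).
  rewrite {1}(coord_vbasis (memvf (bar_of L2 M2 Y))) (lin_sum psi_linear) linear_sum.
  apply/eqP; rewrite subr_eq0; apply/eqP/eq_bigr => i _.
  by rewrite (linZ psi_linear) linearZ /= (flZ (gf_bilin f1)) hX2 mulrC.
have e2E (i : 'I_(\dim {:lbar L2})) : psi e2`_i = \sum_k c i k *: e1`_k.
  by exact: coord_vbasis (memvf _).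
pose F (i j : 'I_(\dim {:lbar L2})) : multivector L2 1 :=
  form1 (fun b => Th (bH (X2 i) (X2 j)) (of_bar M2 b)).
pose B (k : 'I_(\dim {:lbar L1})) : multivector L2 p := pull psi (Defs.contract e1`_k P).
pose C (l : 'I_(\dim {:lbar L1})) : multivector L2 q := pull psi (Defs.contract e1`_l Q).
pose W i j k l := wedge (wedge (F i j) (B k)) (C l) v.
have pullP (i : 'I_(\dim {:lbar L2})) : Defs.contract e2`_i (pull psi P) =
    fun u => \sum_k c i k * B k u.
  apply/funext => u; rewrite /Defs.contract /pull comp_vcons e2E.
  rewrite (scal_sum (is_form_contract_lin (psi \o u) fP)).
  by apply: eq_bigr => k _; rewrite (scalZ (is_form_contract_lin (psi \o u) fP)).
have pullQ (i : 'I_(\dim {:lbar L2})) : Defs.contract e2`_i (pull psi Q) =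
    fun u => \sum_k c i k * C k u.
  apply/funext => u; rewrite /Defs.contract /pull comp_vcons e2E.
  rewrite (scal_sum (is_form_contract_lin (psi \o u) fQ)).
  by apply: eq_bigr => k _; rewrite (scalZ (is_form_contract_lin (psi \o u) fQ)).
have pullF k l : pull psi (form1 (fun b => Th (bH (X1 k) (X1 l)) (of_bar M1 b))) =
    fun u => \sum_i c i k * \sum_j c j l * F i j u.
  apply/funext => u; rewrite /pull /F /form1 /= /psi (bar_ofK f1) !X1E.
  rewrite (lin_sum (bbH.2 _)) (fl_sum (gf_bilin f1)); apply: eq_bigr => i _.
  rewrite (blZ bbH) (flZ (gf_bilin f1)); congr (_ * _).
  rewrite (lin_sum (bbH.1 _)) (fl_sum (gf_bilin f1)); apply: eq_bigr => j _.
  by rewrite (brZ bbH) (flZ (gf_bilin f1)).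
transitivity (\sum_k \sum_l \sum_i c i k * \sum_j c j l * W i j k l).
  apply: eq_bigr => k _; apply: eq_bigr => l _.
  transitivity (wedge (wedge (pull psi (form1 (fun b => Th (bH (X1 k) (X1 l))
    (of_bar M1 b)))) (B k)) (C l) v); first by [].
  rewrite pullF.
  transitivity (wedge (fun u => \sum_i c i k *
    wedge (fun u => \sum_j c j l * F i j u) (B k) u) (C l) v).
    by congr (wedge _ _ v); apply/funext => u; rewrite wedge_suml.
  rewrite wedge_suml; apply: eq_bigr => i _; congr (_ * _).
  transitivity (wedge (fun u => \sum_j c j l * wedge (F i j) (B k) u) (C l) v).
    by congr (wedge _ _ v); apply/funext => u; rewrite wedge_suml.
  by rewrite wedge_suml.
transitivity (\sum_i \sum_j \sum_l c j l * \sum_k c i k * W i j k l).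
  under eq_bigr => k _ do rewrite exchange_big.
  rewrite exchange_big; apply: eq_bigr => i _ /=.
  under eq_bigr => k _ do
    (under eq_bigr => l _ do rewrite mulr_sumr; rewrite exchange_big).
  rewrite exchange_big; apply: eq_bigr => j _ /=.
  rewrite exchange_big; apply: eq_bigr => l _ /=.
  by rewrite mulr_sumr; apply: eq_bigr => k _; rewrite mulrCA.
apply: eq_bigr => i _; apply: eq_bigr => j _; rewrite pullP pullQ wedge_sumr.
apply: eq_bigr => l _; congr (_ * _).
transitivity (wedge (fun u => \sum_k c i k * wedge (F i j) (B k) u) (C l) v).
  by rewrite wedge_suml.
by congr (wedge _ _ v); apply/funext => u; rewrite wedge_sumr.
Qed.

Lemma frame_dga_iso : dga_iso br L1 L2.
Proof.
exists (fun k => pull psi (k := k)); split.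
- move=> k; split.
  + by move=> a /= fa; exact: pull_is_form.
  + move=> a b _ _ ab; apply/funext => v; have := congr1 (pull psi' (k := k)) ab.
    move=> /(congr1 (fun f => f v)); rewrite /pull /=.
    by rewrite (_ : psi \o (psi' \o v) = v) //; apply/funext => i; exact: psi'K.
  move=> b fb; exists (pull psi' b); first exact: pull_is_form.
  apply/funext => v; rewrite /pull; congr b; apply/funext => i; exact: psiK.
- by [].
- by [].
- move=> k a _; apply: pull_ce_d => x y.
  rewrite /psi !(lbar_bracketE f1, lbar_bracketE f2).
  by rewrite !(bar_ofK f1, bar_ofK f2).
exact: frame_iso_schouten.
Qed.

End FrameIso.

Lemma alternating_cyclic_sum (F : numFieldType) (T : Type) n (v : 'I_n -> T)
    (K : T -> T -> T -> F) (i j k : 'I_n) :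
  i != j -> i != k -> j != k ->
  (forall x y z, K x y z + K y z x + K z x y = 0) ->
  \sum_(s : 'S_n) (-1) ^+ s * K (v (s i)) (v (s j)) (v (s k)) = 0.
Proof.
move=> ij ik jk cK; pose f (s : 'S_n) := (-1) ^+ s * K (v (s i)) (v (s j)) (v (s k)).
pose c : 'S_n := (tperm i j * tperm i k)%g.
have ci : c i = j by rewrite permM tpermL tpermD // eq_sym.
have cj : c j = k by rewrite permM tpermR tpermL.
have ck : c k = i by rewrite permM (tpermD ik jk) tpermR.
have even_c : odd_perm c = false by rewrite odd_permM !odd_tperm ij ik.
(* [c] is an even 3-cycle: averaging over it makes the cyclic sums appear. *)
clearbody c; have f1 s : f (c * s)%g = (-1) ^+ s * K (v (s j)) (v (s k)) (v (s i)).
  by rewrite /f odd_permM even_c !permM ci cj ck.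
have f2 s : f (c * (c * s))%g = (-1) ^+ s * K (v (s k)) (v (s i)) (v (s j)).
  by rewrite f1 odd_permM even_c !permM ci cj ck.
have S1 : \sum_s f s = \sum_s f (c * s)%g.
  by rewrite [LHS](reindex_inj (mulgI c)).
have S2 : \sum_s f s = \sum_s f (c * (c * s))%g.
  by rewrite S1 [LHS](reindex_inj (mulgI c)).
suff : \sum_s f s *+ 3 = 0.
  by rewrite sumrMnl => /eqP; rewrite mulrn_eq0 /= => /eqP.
transitivity (\sum_s (f s + f (c * s)%g + f (c * (c * s))%g)).
  by rewrite sumrMnl mulrSr mulr2n {2}S1 {2}S2 !big_split.
by rewrite big1 // => s _; rewrite f1 f2 -!mulrDr cK mulr0.
Qed.

Section FrameDeform.
Variables (R : realType) (h : vectType R) (br : h -> h -> h).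
Local Notation cdbl := (cplx (h * 'Hom(h, R^o))%type).
Variables (L : {vspace cdbl}) (H : vectType R[i]) (bH : H -> H -> H).
Variables (Th : H -> H -> R[i]) (N M : H -> cdbl).
Hypothesis fr : gcs_frame br L bH Th N M.
Hypothesis bbH : bilin bH.

Lemma schouten_form2_eq0 (G : lbar L -> lbar L -> R[i]) (Z : lbar L -> H) v :
  bilin_form G ->
  (forall b Y, Th (Z b) Y = G (bar_of L M Y) b) ->
  (forall a b c, Th (bH (Z b) (Z c)) (of_bar M a) +
    Th (bH (Z c) (Z a)) (of_bar M b) + Th (bH (Z a) (Z b)) (of_bar M c) = 0) ->
  schouten br (form2 G : multivector L 1.+1) (form2 G : multivector L 1.+1) v = 0.
Proof.
move=> bG hZ cyc; pose e := vbasis (fullv : {vspace lbar L}).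
have bTh := gf_bilin fr.
have ex i : exists X, forall Y, Th X Y = coord e i (bar_of L M Y).
  by apply: (sharp_ex fr) => a x y; rewrite linearP.
have [X hX] := fin_all_exists ex.
rewrite (schoutenE fr _ _ _ hX).
pose K (a b c : lbar L) : R[i] := Th (bH (Z b) (Z c)) (of_bar M a).
pose J := 'I_(\dim {:lbar L}).
have ZE b : Z b = \sum_(i : J) G e`_i b *: X i.
  apply/eqP; rewrite -subr_eq0; apply/eqP/(gf_nondegl fr) => Y.
  rewrite (flD bTh) (flN bTh) (fl_sum bTh) hZ.
  rewrite {1}(coord_vbasis (memvf (bar_of L M Y))) (fl_sum bG).
  apply/eqP; rewrite subr_eq0; apply/eqP/eq_bigr => i _.
  by rewrite (flZ bG) (flZ bTh) hX mulrC.
have KE a b c : K a b c = \sum_(i : J) \sum_(j : J)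
    Th (bH (X i) (X j)) (of_bar M a) * G e`_i b * G e`_j c.
  rewrite /K (ZE b) (lin_sum (bbH.2 _)) (fl_sum bTh); apply: eq_bigr => i _.
  rewrite (blZ bbH) (flZ bTh) (ZE c) (lin_sum (bbH.1 _)) (fl_sum bTh) mulr_sumr.
  apply: eq_bigr => j _; rewrite (brZ bbH) (flZ bTh).
  by rewrite [RHS]mulrC mulrCA; congr (_ * _); exact: mulrC.
pose w (s : 'S_(1 + 1 + 1)) (r : 'S_(1 + 1)) := K (v (s (lshift 1 (r (lshift 1 ord0)))))
  (v (s (lshift 1 (r (rshift 1 ord0))))) (v (s (rshift (1 + 1) ord0))).
pose a1 : R[i] := ((1 + 1)`! * 1`!)%:R^-1; pose a2 : R[i] := (1`! * 1`!)%:R^-1.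
transitivity (a1 * \sum_(s : 'S_(1 + 1 + 1)) \sum_(r : 'S_(1 + 1))
  (-1) ^+ s * (a2 * (-1) ^+ r) * w s r).
  transitivity (\sum_(i : J) \sum_(j : J) a1 * \sum_(s : 'S_(1 + 1 + 1)) \sum_(r : 'S_(1 + 1))
     (-1) ^+ s * (a2 * (-1) ^+ r) *
     (Th (bH (X i) (X j)) (of_bar M (v (s (lshift 1 (r (lshift 1 ord0)))))) *
      G e`_i (v (s (lshift 1 (r (rshift 1 ord0))))) * G e`_j (v (s (rshift (1 + 1) ord0))))).
    apply: eq_bigr => i _; apply: eq_bigr => j _; rewrite {1}/wedge; congr (_ * _).
    apply: eq_bigr => s _; rewrite /wedge /Defs.contract !form2_vcons.
    rewrite mulr_sumr mulr_suml mulr_sumr.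
    apply: eq_bigr => r _.
    by rewrite form2_vcons /a2 /form1 !mulrA.
  under [LHS]eq_bigr => i _ do rewrite -mulr_sumr exchange_big.
  rewrite -mulr_sumr exchange_big; congr (_ * _); apply: eq_bigr => s _ /=.
  under [LHS]eq_bigr => i _ do rewrite exchange_big.
  rewrite exchange_big; apply: eq_bigr => r _ /=.
  rewrite /w KE mulr_sumr; apply: eq_bigr => i _.
  by rewrite mulr_sumr.
rewrite exchange_big big1 ?mulr0 // => r _.
transitivity (a2 * (-1) ^+ r * \sum_(s : 'S_(1 + 1 + 1)) (-1) ^+ s * w s r).
  by rewrite mulr_sumr; apply: eq_bigr => s _; rewrite [(-1) ^+ s * _]mulrC mulrA.
rewrite alternating_cyclic_sum ?mulr0 //.
- by rewrite (inj_eq (@lshift_inj _ _)) (inj_eq perm_inj).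
- by rewrite eq_lrshift.
- by rewrite eq_lrshift.
Qed.

Lemma deformedE (G : multivector L 2) (D : H -> cdbl) :
  linear D -> (forall X, N X + conj_contract G (N X) = D X) ->
  forall l, l \in deformed G <-> exists X, l = D X.
Proof.
move=> lD hD.
exact: (mem_span_map (f := fun l => l + conj_contract G l) (gf_linN fr) lD
  (gf_N0 fr) (gf_N fr) hD).
Qed.

Lemma conj_contract_form2 (G : lbar L -> lbar L -> R[i]) l X Z :
  cconj l = M X -> (forall Y, Th Z Y = G (bar_of L M X) (bar_of L M Y)) ->
  conj_contract (form2 G) l = cconj (N Z).
Proof.
move=> lX hZ; rewrite /conj_contract lX; congr cconj.
apply: (sharp_eq fr) => Y; rewrite hZ form2_vcons //.
Qed.

End FrameDeform.

Section SymplecticFrame.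
Variables (R : realType) (h : vectType R) (br : h -> h -> h).
Hypotheses (bbr : bilin br) (abr : forall x, br x x = 0).
Local Notation dbl := (h * 'Hom(h, R^o))%type.

Definition symp_frame1 (B : h -> h -> R) (X : h) : dbl := (X, int_prod B X).
Definition symp_frame2 (Om : h -> h -> R) (X : h) : dbl := (0, - int_prod Om X).

Lemma closed_int_prod B : closed_2form br B -> forall x y,
  int_prod B (br x y) = lie_der br x (int_prod B y) - lie_der br y (int_prod B x).
Proof.
move=> /(closed_2formP _ bbr abr)[bB aB cB] x y; apply/lfunP => z.
rewrite add_lfunE opp_lfunE !lie_derE // !int_prodE //.
have := cB x y z; have := skew_alt bB aB.
rewrite (alt_skew bbr abr z x) (flN bB) => sB; rewrite [B (br y z) x]sB [B (br x z) y]sB.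
by move=> ?; lra.
Qed.

Lemma symplectic_real_frame B Om : closed_2form br B -> symplectic_form br Om ->
  real_frame br (symp_frame1 B) (symp_frame2 Om) Om.
Proof.
move=> cB [cOm nOm].
have [bB aB _] := (closed_2formP _ bbr abr).1 cB.
have [bO aO _] := (closed_2formP _ bbr abr).1 cOm.
have lB := int_prod_linear bB; have lO := int_prod_linear bO.
have bd := dorfman_bilin bbr; have bl := lie_der_bilin bbr.
have l0 x : lie_der br 0 x = 0 by rewrite (bl0 bl).
split.
- by move=> a x y; rewrite /symp_frame1 lB.
- by move=> a x y; rewrite /symp_frame2 lO opprD -scalerN; congr pair;
    rewrite /= scaler0 addr0.
- move=> x y; rewrite /dorfman /symp_frame1 /symp_frame2 /= !l0 !(bilE bbr).
  by rewrite closed_int_prod // subrr; congr pair; rewrite /= ?subr0.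
- move=> x y; rewrite /dorfman /symp_frame1 /symp_frame2 /= !l0 !(bilE bbr).
  rewrite closed_int_prod // !(brN bl) subr0 sub0r opprK opprB addrC.
  by congr pair; rewrite /= ?addr0.
- move=> x y; rewrite /pairing /= !int_prodE // (skew_alt bB aB y) addrN mulr0 //.
- by move=> x y; rewrite /pairing /= !linear0 addr0 mulr0.
- move=> x y; rewrite /pairing /= linear0 add0r opp_lfunE int_prodE //.
  by rewrite (skew_alt bO aO y) opprK.
- exact: skew_alt.
exact: nOm.
Qed.

Lemma symp_frame1_linear B : bilin_form B -> linear (symp_frame1 B).
Proof. by move=> bB a x y; rewrite /symp_frame1 (int_prod_linear bB). Qed.

Lemma symp_frame2_linear Om : bilin_form Om -> linear (symp_frame2 Om).
Proof.
move=> bO a x y; rewrite /symp_frame2 (int_prod_linear bO) opprD -scalerN.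
by congr pair; rewrite /= scaler0 addr0.
Qed.

Lemma zero_bilin_form : bilin_form (fun _ _ : h => 0 : R).
Proof. by split=> ? ? ? ?; rewrite mulr0 addr0. Qed.

Lemma limg_linfunP (K : fieldType) (U W : vectType K) (f : U -> W) : linear f ->
  forall l, l \in limg (linfun f) <-> exists X, l = f X.
Proof.
move=> lf l; split=> [/memv_imgP[X _ ->]|[X ->]].
  by exists X; rewrite linfunP.
by rewrite -(linfunP lf) memv_img // memvf.
Qed.

Lemma gcs_symplecticP (Om : h -> h -> R) l : bilin_form Om ->
  l \in gcs_symplectic Om <->
  exists X, l = frame_map (symp_frame1 (fun _ _ => 0)) (symp_frame2 Om) X.
Proof.
move=> bO; pose f := frame_map (symp_frame1 (fun _ _ => 0)) (symp_frame2 Om).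
have -> : gcs_symplectic Om = limg (linfun f).
  congr (limg (linfun _)); apply/funext => X; rewrite /f.
  have i0 x : int_prod (fun _ _ => 0) x = 0 :> 'Hom(h, R^o).
    by apply/lfunP => y; rewrite int_prodE ?zero_lfunE //; exact: zero_bilin_form.
  apply: cplx_eq; rewrite /= /symp_frame1 /symp_frame2 !i0 scale0r scale1r.
    by congr pair; rewrite /= ?subr0 ?sub0r ?opprK ?add0r ?oppr0 ?addr0.
  by rewrite add0r; congr pair; rewrite /= ?subr0 ?addr0.
apply: limg_linfunP; apply: frame_map_linear.
  exact/symp_frame1_linear/zero_bilin_form.
exact: symp_frame2_linear.
Qed.

Lemma b_transformP (B Om : h -> h -> R) l : bilin_form B -> bilin_form Om ->
  l \in b_transform B (gcs_symplectic Om) <->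
  exists X, l = frame_map (symp_frame1 B) (symp_frame2 Om) X.
Proof.
move=> bB bO.
pose bt (e : dbl) : dbl := (e.1, e.2 + int_prod B e.1).
have lbt : linear bt.
  by move=> a x y; congr pair; rewrite /= (int_prod_linear bB) scalerDr addrACA.
have lcm := cmap_linear lbt.
have tE X : cmap bt (frame_map (symp_frame1 (fun _ _ => 0)) (symp_frame2 Om) X) =
    frame_map (symp_frame1 B) (symp_frame2 Om) X.
  have i0 x : int_prod (fun _ _ => 0) x = 0 :> 'Hom(h, R^o).
    by apply/lfunP => y; rewrite int_prodE ?zero_lfunE //; exact: zero_bilin_form.
  apply: cplx_eq; rewrite /= /bt /symp_frame1 /symp_frame2 !i0 /=; congr pair.
    by rewrite /= subr0 sub0r addrC.
  by rewrite /= addr0 add0r addrC.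
split=> [/memv_imgP[l' /(gcs_symplecticP _ bO)[X ->] ->]|[X ->]].
  by exists X; rewrite (linfunP lcm) tE.
rewrite -tE -(linfunP lcm) memv_img //.
by apply/(gcs_symplecticP _ bO); exists X.
Qed.

End SymplecticFrame.

Section SemiDirect.
Variables (R : realType) (V : vectType R) (br : V -> V -> V) (w : V -> V -> R).
Variable gamma : V -> 'End(V).
Hypotheses (hbr : is_lie_bracket br) (hw : symplectic_form br w).
Hypothesis hgamma : torsion_free_flat_symplectic br w gamma.

Local Notation sd := (sd_bracket br gamma).
Local Notation Om2 := (sd_Omega2 w).

Lemma lie_bilin : bilin br. Proof. by case: hbr. Qed.
Lemma lie_alt x : br x x = 0. Proof. by case: hbr. Qed.
Let bbr := lie_bilin.
Let cw := (closed_2formP w bbr lie_alt).1 hw.1.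

Lemma w_bilin : bilin_form w. Proof. by case: cw. Qed.
Lemma w_skew x y : w x y = - w y x.
Proof. by apply: skew_alt; [exact: w_bilin | case: cw]. Qed.
Let bw := w_bilin.

Lemma gammaD x y u : gamma (x + y) u = gamma x u + gamma y u.
Proof. by case: hgamma => lg _ _ _; rewrite (linD lg) add_lfunE. Qed.
Lemma gammaZ a x u : gamma (a *: x) u = a *: gamma x u.
Proof. by case: hgamma => lg _ _ _; rewrite (linZ lg) scale_lfunE. Qed.
Lemma gamma_bilin : bilin (fun x u => gamma x u).
Proof.
split=> [x|u] a y z; first by rewrite linearP.
by rewrite gammaD gammaZ.
Qed.
Let bg := gamma_bilin.

Lemma gamma0 u : gamma 0 u = 0. Proof. exact: (bl0 bg). Qed.
Lemma gammaN x u : gamma (- x) u = - gamma x u. Proof. exact: (blN bg). Qed.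
Lemma gammar0 x : gamma x 0 = 0. Proof. exact: linear0. Qed.
Lemma gammarN x u : gamma x (- u) = - gamma x u. Proof. exact: linearN. Qed.
Definition gammaE := (gamma0, gammaN, gammar0, gammarN).

Lemma torsionE x y : br x y = gamma x y - gamma y x.
Proof. by case: hgamma. Qed.
Lemma w_gamma x y z : w (gamma x y) z = - w y (gamma x z).
Proof. by case: hgamma => _ _ gw _; apply/eqP; rewrite -addr_eq0 gw. Qed.

Lemma sd_bilin : bilin sd.
Proof.
split=> [X a Y Z|Y a X Z]; congr pair => /=;
  rewrite ?(blD bbr) ?(blZ bbr) ?(brD bbr) ?(brZ bbr) //.
  by rewrite gammaD gammaZ linearP scalerBr opprD addrACA.
by rewrite gammaD gammaZ linearP scalerBr opprD addrACA.
Qed.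

Lemma sd_alt X : sd X X = 0.
Proof. by rewrite /sd_bracket lie_alt subrr. Qed.

Definition sd_Omega1 (X Y : V * V) : R := w X.1 Y.2 + w X.2 Y.1.
Definition vert_form (X Y : V * V) : R := w X.2 Y.2.
Local Notation Om1 := sd_Omega1.

Lemma Om1_bilin : bilin_form Om1.
Proof. split=> [X a Y Z|Y a X Z]; rewrite /Om1 /= !(formE bw); ring. Qed.
Lemma Om2_bilin : bilin_form Om2.
Proof. split=> [X a Y Z|Y a X Z]; rewrite /sd_Omega2 /= !(formE bw); ring. Qed.
Lemma vert_bilin : bilin_form vert_form.
Proof. split=> [X a Y Z|Y a X Z]; rewrite /vert_form /= !(formE bw); ring. Qed.

Lemma w_cyclic x y z : w (br x y) z + w (br y z) x + w (br z x) y = 0.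
Proof. by case: cw. Qed.

Lemma vert_cyclic X Y Z : vert_form (sd X Y) Z + vert_form (sd Y Z) X +
  vert_form (sd Z X) Y = 0.
Proof.
case: X Y Z => [x u] [y v] [z t]; rewrite /vert_form /sd_bracket /=.
rewrite !(formE bw) (w_gamma x v) (w_gamma z u) (w_gamma y t).
rewrite [w v _]w_skew [w u _]w_skew [w t _]w_skew; ring.
Qed.

Lemma Om1_closed : closed_2form sd Om1.
Proof.
apply/(closed_2formP _ sd_bilin sd_alt); split; first exact: Om1_bilin.
  by move=> [x u]; rewrite /Om1 /= [w u x]w_skew addrN.
move=> [x u] [y v] [z t]; rewrite /Om1 /sd_bracket /= !torsionE !(formE bw).
have sym a b c : w (gamma a b) c = w (gamma a c) b.
  by rewrite w_gamma w_skew opprK.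
rewrite (sym x y t) (sym y x t) (sym y z u) (sym z y u) (sym z x v) (sym x z v).
ring.
Qed.

Lemma Om2_closed : closed_2form sd Om2.
Proof.
apply/(closed_2formP _ sd_bilin sd_alt); split; first exact: Om2_bilin.
  by move=> [x u]; rewrite /sd_Omega2 /=; have := w_skew x x; have := w_skew u u; lra.
move=> X Y Z; have := vert_cyclic X Y Z; have := w_cyclic X.1 Y.1 Z.1.
rewrite /vert_form /sd_Omega2 /=; lra.
Qed.

Lemma Om1_nondegenerate : nondegenerate_form Om1.
Proof.
move=> [x u] xu; congr pair; apply: hw.2 => y.
  by have := xu (0, y); rewrite /Om1 /= (fr0 bw) addr0.
by have := xu (y, 0); rewrite /Om1 /= (fr0 bw) add0r.
Qed.

Lemma Om2_nondegenerate : nondegenerate_form Om2.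
Proof.
move=> [x u] xu; congr pair; apply: hw.2 => y.
  by have := xu (y, 0); rewrite /sd_Omega2 /= (fr0 bw) subr0.
by have := xu (0, - y); rewrite /sd_Omega2 /= (fr0 bw) sub0r (frN bw) opprK.
Qed.

(* In complex notation, (x, u) is sent to (x, - i x) + iota_(- i u, u) Omega_2. *)
Definition cplx_frame1 (X : V * V) : (V * V) * 'Hom((V * V)%type, R^o) :=
  ((X.1, 0), int_prod Om2 (0, X.2)).
Definition cplx_frame2 (X : V * V) : (V * V) * 'Hom((V * V)%type, R^o) :=
  ((0, - X.1), int_prod Om2 (- X.2, 0)).

Lemma complex_real_frame : real_frame sd cplx_frame1 cplx_frame2 Om1.
Proof.
have bO := Om2_bilin; have lO := int_prod_linear bO.
split.
- move=> a x y; rewrite /cplx_frame1; congr pair => /=.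
    by congr pair; rewrite /= scaler0 addr0.
  by rewrite -lO; congr int_prod; congr pair; rewrite /= scaler0 addr0.
- move=> a x y; rewrite /cplx_frame2; congr pair => /=.
    by congr pair; rewrite /= ?scaler0 ?addr0 ?opprD ?scalerN.
  by rewrite -lO; congr int_prod; congr pair; rewrite /= ?scaler0 ?addr0 ?opprD ?scalerN.
- move=> [x u] [y v]; rewrite /dorfman /cplx_frame1 /cplx_frame2 /=; congr pair.
    rewrite /sd_bracket /=; congr pair; rewrite /= ?(bilE bbr) ?gammaE ?subr0 //.
  apply/lfunP => [[z t]] /=.
  rewrite !(add_lfunE, opp_lfunE) !(lie_derE sd_bilin) !int_prodE //.
  rewrite /sd_Omega2 /sd_bracket /= !(bilE bbr, gammaE, formE bw).
  by rewrite !w_gamma; ring.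
- move=> [x u] [y v]; rewrite /dorfman /cplx_frame1 /cplx_frame2 /=; congr pair.
    rewrite /sd_bracket /=; congr pair; rewrite /= ?(bilE bbr) ?gammaE ?subr0 ?addr0 //.
    by rewrite sub0r opprK torsionE opprB addrC.
  apply/lfunP => [[z t]] /=.
  rewrite !(add_lfunE, opp_lfunE) !(lie_derE sd_bilin) !int_prodE //.
  rewrite /sd_Omega2 /sd_bracket /= !torsionE !(bilE bbr, gammaE, formE bw).
  by rewrite !w_gamma; ring.
- move=> [x u] [y v]; rewrite /pairing /= !int_prodE // /sd_Omega2 /= !(formE bw); ring.
- move=> [x u] [y v]; rewrite /pairing /= !int_prodE // /sd_Omega2 /= !(formE bw); ring.
- move=> [x u] [y v]; rewrite /pairing /= !int_prodE // /sd_Omega2 /Om1 /= !(formE bw).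
  by rewrite [w v x]w_skew; ring.
- by move=> [x u] [y v]; rewrite /Om1 /= [w y u]w_skew [w v x]w_skew; ring.
exact: Om1_nondegenerate.
Qed.

Lemma mem_leigenspace (W : vectType R) (f : W -> W) a X : linear f ->
  X \in passmx.leigenspace (linfun (cmap f : cplx W -> cplx W)) a <->
  cmap f X = a *: X.
Proof.
move=> lf; rewrite /passmx.leigenspace memv_ker add_lfunE opp_lfunE scale_lfunE.
rewrite id_lfunE (linfunP (cmap_linear lf)) subr_eq0.
by split=> /eqP.
Qed.

Lemma sd_J_linear : linear (@sd_J R V).
Proof.
by move=> a [x u] [y v]; rewrite /sd_J; congr pair; rewrite /= opprD scalerN.
Qed.

Lemma pullbackE (J : V * V -> V * V) (a : 'Hom((V * V)%type, R^o)) Z :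
  linear J -> pullback J a Z = a (J Z).
Proof.
by move=> lJ; rewrite /pullback (linfunP (W := R^o)) // => b x y; rewrite lJ linearP.
Qed.

Lemma pullback_linear (J : V * V -> V * V) : linear J -> linear (pullback J).
Proof.
move=> lJ a x y; apply/lfunP => Z.
by rewrite add_lfunE scale_lfunE !pullbackE // add_lfunE scale_lfunE.
Qed.

Lemma gcs_complexP l :
  l \in gcs_complex (@sd_J R V) <->
  exists X, l = frame_map cplx_frame1 cplx_frame2 X.
Proof.
have bO := Om2_bilin; have lO := int_prod_linear bO; have lJ := sd_J_linear.
have lpJ := pullback_linear lJ.
have lv : linear (@vec_part R (V * V)%type).
  by apply: cmap_linear => a x y; congr pair; rewrite /= scaler0 addr0.
have lc : linear (@cov_part R (V * V)%type).
  by apply: cmap_linear => a x y; congr pair; rewrite /= scaler0 addr0.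
have JO X : pullback (@sd_J R V) (int_prod Om2 X) = int_prod Om2 (sd_J X).
  apply/lfunP => Z; rewrite pullbackE // !int_prodE // /sd_Omega2 /=.
  by rewrite !(formE bw); ring.
have frameE x u x' u' : frame_map cplx_frame1 cplx_frame2 ((x, u), (x', u')) =
    vec_part ((x, x'), (x', - x)) +
    cov_part (int_prod Om2 (u', u), int_prod Om2 (- u, u')).
  apply: cplx_eq; congr pair; rewrite /= ?addr0 ?add0r -?(linB lO) -?(linD lO).
  - by congr pair; rewrite /= ?subr0 ?sub0r ?opprK.
  - by congr int_prod; congr pair; rewrite /= ?subr0 ?sub0r ?opprK.
  - by congr pair; rewrite /= ?addr0 ?add0r.
  - by congr int_prod; congr pair; rewrite /= ?addr0 ?add0r.
split=> [/memv_addP[_ /memv_imgP[Y hY ->] [_ /memv_imgP[a ha ->] ->]]|[[[x u] [x' u']] ->]].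
  rewrite (linfunP lv) (linfunP lc).
  move/(mem_leigenspace _ _ lJ): hY => hY.
  move/(mem_leigenspace _ _ lpJ): ha => ha.
  have [[u' u] hu] : exists X, forall Z, Om2 X Z = a.1 Z.
    apply: (nondegenerate_repr bO Om2_nondegenerate (p := fun Z => a.1 Z)) => b Z Z'.
    by rewrite linearP.
  exists ((Y.1.1, u), (Y.1.2, u')); rewrite frameE.
  have a1 : a.1 = int_prod Om2 (u', u) by apply/lfunP => Z; rewrite int_prodE.
  have a2 : a.2 = pullback (@sd_J R V) a.1.
    by have := congr1 fst ha; rewrite /= oppr0 scale0r scaleN1r sub0r opprK.
  have Y2 : Y.2 = - sd_J Y.1.
    by have := congr1 fst hY; rewrite /= scale0r scale1r sub0r => ->; rewrite opprK.
  congr (vec_part _ + cov_part _); apply: cplx_eq => //=.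
  - by case: (Y.1).
  - by rewrite Y2; congr pair; rewrite /= opprK.
  by rewrite a2 a1 JO.
rewrite frameE; apply: memv_add.
  rewrite -(linfunP lv) memv_img //; apply/(mem_leigenspace _ _ lJ).
  apply: cplx_eq; rewrite /sd_J /= scale0r scale1r ?sub0r ?add0r ?opprK //.
  by congr pair; rewrite /= opprK.
rewrite -(linfunP lc) memv_img //; apply/(mem_leigenspace _ _ lpJ).
apply: cplx_eq; rewrite /= !JO oppr0 !scale0r scaleN1r ?sub0r ?add0r ?opprK //.
by rewrite -(linN lO).
Qed.

End SemiDirect.

Section Deformation.
Variables (R : realType) (V : vectType R) (br : V -> V -> V) (w : V -> V -> R).
Variable gamma : V -> 'End(V).
Hypotheses (hbr : is_lie_bracket br) (hw : symplectic_form br w).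
Hypothesis hgamma : torsion_free_flat_symplectic br w gamma.

Local Notation sd := (sd_bracket br gamma).
Local Notation Om1 := (sd_Omega1 w).
Local Notation Om2 := (sd_Omega2 w).
Local Notation n1 := (cplx_frame1 w).
Local Notation n2 := (cplx_frame2 w).
Local Notation L := (gcs_complex (@sd_J R V)).
Local Notation N := (frame_map n1 n2).
Local Notation M := (frame_map n1 (fun x => - n2 x)).

Let bsd := sd_bilin hbr hgamma.
Let rf := complex_real_frame hbr hw hgamma.
Let LN := gcs_complexP hbr hw.
Let fr := real_frame_frame bsd rf LN.
Let bw := w_bilin hbr hw.
Let bv := vert_bilin hbr hw.
Let bcv := cpair_bilin bv.

(* The holomorphic Poisson structure inverse to the holomorphic symplectic form
   Omega_2 + i Omega_1, multiplied by a constant and by [t]. *)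
Definition poisson_path (t : R) : multivector L 2 := form2 (fun b b' : lbar L =>
  (0 +i* (- t)) * cpair (vert_form w) (of_bar M b) (of_bar M b')).

Lemma poisson_path_bilin t : bilin_form (fun b b' : lbar L =>
  (0 +i* (- t)) * cpair (vert_form w) (of_bar M b) (of_bar M b')).
Proof.
split=> [x a y z|y a x z]; rewrite of_bar_linear.
  by rewrite (frD bcv) (frZ bcv) mulrDr mulrCA.
by rewrite (flD bcv) (flZ bcv) mulrDr mulrCA.
Qed.

Lemma vert_alt X : vert_form w X X = 0.
Proof. by rewrite /vert_form; have := w_skew hbr hw X.2 X.2; lra. Qed.

Lemma poisson_path_form t : is_form (poisson_path t).
Proof.
apply/form2P; split; first exact: poisson_path_bilin.
by move=> b; rewrite (cpair_alt bv vert_alt) mulr0.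
Qed.

Lemma poisson_path_dbar t v : dbar sd (poisson_path t) v = 0.
Proof.
rewrite /dbar /poisson_path ce_d_form2 !(lbar_bracketE fr) !(bar_ofK fr).
have := cpair_cbil_cyclic bv (vert_cyclic hbr hw hgamma) (of_bar M (v ord0))
  (of_bar M (v (lift ord0 ord0))) (of_bar M (v ord_max)).
rewrite (alt_skew (cbil_bilin bsd) (cbil_alt bsd (sd_alt gamma hbr))
  (of_bar M (v ord_max))).
rewrite (flN bcv); move: (cpair _ _ _) (cpair _ _ _) (cpair _ _ _) (0 +i* - t).
move=> p q r c pqr; rewrite -[RHS](mulr0 (- c)) -pqr; ring.
Qed.

Definition shear (c : R) (X : V * V) : V * V := (c *: X.2, 0).

Lemma shear_linear c : linear (shear c).
Proof.
move=> a x y; rewrite /shear; congr pair; rewrite /= ?scaler0 ?addr0 //.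
by rewrite scalerDr !scalerA mulrC.
Qed.

Lemma cpair_shear c X Y :
  cpair Om1 (cmap (shear c) X) Y = c%:C * cpair (vert_form w) X Y.
Proof.
apply: complex_eq; rewrite /= /sd_Omega1 /vert_form /= !(formE bw); ring.
Qed.

Lemma poisson_path_schouten t v :
  schouten sd (poisson_path t : multivector L 1.+1) (poisson_path t) v = 0.
Proof.
apply: (schouten_form2_eq0 fr (cbil_bilin bsd)
  (Z := fun b => cmap (shear (- (t / 2))) (of_bar M b))).
- exact: poisson_path_bilin.
- move=> b Y; rewrite cpair_shear (bar_ofK fr).
  rewrite [X in _ = _ * X](skew_alt bcv (cpair_alt bv vert_alt)).
  by apply: complex_eq; rewrite /=; field.
move=> a b c; pose u (e : lbar L) : cplx V := cmap snd (of_bar M e).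
have E (A B C : cplx (V * V)%type) : cpair Om1 (cbil sd (cmap (shear (- (t / 2))) B)
    (cmap (shear (- (t / 2))) C)) A =
    ((t / 2) ^+ 2)%:C * cpair w (cbil br (cmap snd B) (cmap snd C)) (cmap snd A).
  have bbr := lie_bilin hbr.
  apply: complex_eq; rewrite /= /sd_Omega1 /= !(gammar0, bilE bbr, formE bw); ring.
rewrite !E -!mulrDr.
by rewrite (cpair_cbil_cyclic bw (w_cyclic hbr hw) (u b) (u c) (u a)) !mulr0.
Qed.

Lemma poisson_path_mc t : maurer_cartan sd (poisson_path t).
Proof.
by move=> v; rewrite poisson_path_dbar poisson_path_schouten mulr0 addr0.
Qed.

Lemma conj_contract_path t X :
  conj_contract (poisson_path t) (N X) = M (cmap (shear (t / 2)) X).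
Proof.
rewrite (conj_contract_form2 fr (X := cconj X)
  (Z := cmap (shear (t / 2)) (cconj X))).
- rewrite (real_frame_conj rf); congr (frame_map _ _ _).
  by apply: cplx_eq; rewrite /= ?(linN (shear_linear _)) ?opprK.
- by rewrite (real_frame_conj rf).
move=> Y; rewrite cpair_shear !(bar_ofK fr).
by apply: complex_eq; rewrite /=; field.
Qed.

Lemma deformed_path t l : l \in deformed (poisson_path t) <->
  exists X, l = N X + M (cmap (shear (t / 2)) X).
Proof.
apply: (deformedE fr (D := fun X => N X + M (cmap (shear (t / 2)) X))).
  move=> a X Y; rewrite (gf_linN fr) (cmap_linear (shear_linear _)) (gf_linM fr).
  by rewrite scalerDr addrACA.
by move=> X; rewrite conj_contract_path.
Qed.

Lemma deformed_path0 : deformed (poisson_path 0) = L.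
Proof.
have NE X : N X + M (cmap (shear (0 / 2)) X) = N X.
  have -> : cmap (shear (0 / 2)) X = 0.
    by apply: cplx_eq; rewrite /= /shear mul0r scale0r.
  by rewrite (lin0 (gf_linM fr)) addr0.
apply/vspaceP => l; apply/idP/idP => [/deformed_path[X ->]|/LN[X ->]].
  by apply/LN; exists X; rewrite NE.
by apply/deformed_path; exists X; rewrite NE.
Qed.

Lemma deformed_path_symp s t : s * t = 1 -> forall l,
  l \in deformed (poisson_path t) <-> exists Y, l =
    frame_map (symp_frame1 (fun X Y => - (s * Om1 X Y)))
      (symp_frame2 (fun X Y => s * Om2 X Y)) Y.
Proof.
move=> st l; rewrite deformed_path.
have s0 : s != 0.
  by apply/eqP => s0; move: st; rewrite s0 mul0r => /eqP; rewrite eq_sym oner_eq0.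
have {st} tE : t = s^-1 by rewrite -[RHS]mulr1 -st mulKf.
pose base (X : cplx (V * V)%type) : cplx (V * V)%type :=
  ((X.1.1 + (t / 2) *: X.1.2, X.2.1 - (t / 2) *: X.2.2),
   (X.2.1 + (t / 2) *: X.2.2, - X.1.1 + (t / 2) *: X.1.2)).
have bB : bilin_form (fun X Y => - (s * Om1 X Y)).
  have b1 := Om1_bilin hbr hw.
  by split=> [X a Y Z|Y a X Z]; rewrite !(formE b1); ring.
have bO : bilin_form (fun X Y => s * Om2 X Y).
  have b2 := Om2_bilin hbr hw.
  by split=> [X a Y Z|Y a X Z]; rewrite !(formE b2); ring.
have bO2 := Om2_bilin hbr hw.
have baseE X : N X + M (cmap (shear (t / 2)) X) =
    frame_map (symp_frame1 (fun X Y => - (s * Om1 X Y)))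
      (symp_frame2 (fun X Y => s * Om2 X Y)) (base X).
  case: X => [[x u] [x' u']]; apply: cplx_eq; congr pair => /=.
  - by congr pair; rewrite /= ?scaler0 ?subr0 ?sub0r ?oppr0 ?addr0 ?opprK.
  - apply/lfunP => [[z y]]; rewrite !(add_lfunE, opp_lfunE, int_prodE) //.
    by rewrite /sd_Omega1 /sd_Omega2 /= !(formE bw) tE; field.
  - by congr pair; rewrite /= ?scaler0 ?subr0 ?sub0r ?oppr0 ?addr0 ?add0r ?opprK.
  apply/lfunP => [[z y]]; rewrite !(add_lfunE, opp_lfunE, int_prodE) //.
  by rewrite /sd_Omega1 /sd_Omega2 /= !(formE bw) tE; field.
split=> [[X ->]|[[[a b] [c d]] ->]]; first by exists (base X).
exists ((2^-1 *: (a - d), s *: (a + d)), (2^-1 *: (b + c), s *: (c - b))).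
have half (p : V) : 2^-1 *: p + 2^-1 *: p = p.
  by rewrite -scalerDl (_ : 2^-1 + 2^-1 = 1 :> R) ?scale1r //; lra.
have tsK : t / 2 * s = 2^-1 by rewrite tE; field.
have h2 (p q : V) : 2^-1 *: (p - q + (p + q)) = p.
  by rewrite addrACA addNr addr0 scalerDr half.
rewrite baseE; congr (frame_map _ _ _); rewrite /base /= !scalerA tsK.
congr pair; congr pair; rewrite -?scalerN -?scalerDr ?opprB.
- by rewrite h2.
- by rewrite addrC h2.
- by rewrite addrC (addrC b) h2.
- by rewrite (addrC a) h2.
Qed.

Lemma scaled_symplectic s : s != 0 ->
  closed_2form sd (fun X Y => - (s * Om1 X Y)) /\
  symplectic_form sd (fun X Y => s * Om2 X Y).
Proof.
move=> s0.
have asd := sd_alt gamma hbr.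
have [b1 a1 c1] := (closed_2formP _ bsd asd).1 (Om1_closed hbr hw hgamma).
have [b2 a2 c2] := (closed_2formP _ bsd asd).1 (Om2_closed hbr hw hgamma).
split; last split.
- apply/(closed_2formP _ bsd asd); split=> [|X|X Y Z]; last 2 first.
  + by rewrite a1 mulr0 oppr0.
  + by rewrite -!opprD -!mulrDr c1 mulr0 oppr0.
  by split=> [X a Y Z|Y a X Z]; rewrite !(formE b1); ring.
- apply/(closed_2formP _ bsd asd); split=> [|X|X Y Z]; last 2 first.
  + by rewrite a2 mulr0.
  + by rewrite -!mulrDr c2 mulr0.
  by split=> [X a Y Z|Y a X Z]; rewrite !(formE b2); ring.
move=> X hX; apply: (Om2_nondegenerate hbr hw) => Y.
by move: (hX Y) => /eqP; rewrite mulf_eq0 (negPf s0) => /eqP.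
Qed.

Lemma deformed_path_gcs t : is_gcs sd (deformed (poisson_path t)).
Proof.
have [->|t0] := eqVneq t 0.
  by rewrite deformed_path0; exact (real_frame_gcs bsd rf LN).
have [cB sO] := scaled_symplectic (invr_neq0 t0).
apply: (real_frame_gcs bsd
  (symplectic_real_frame bsd (sd_alt gamma hbr) cB sO)).
by apply: deformed_path_symp; exact: mulVf.
Qed.

Lemma complex_deforms_to_symplectic : deforms_to sd L
  (b_transform (fun X Y => - Om1 X Y) (gcs_symplectic Om2)).
Proof.
exists poisson_path; split.
- move=> t _; split; first exact: poisson_path_form.
    exact: poisson_path_mc.
  exact: deformed_path_gcs.
- move=> v; rewrite /poisson_path /form2.
  set c := cpair _ _ _.
  split; apply: continuous_subspaceT.
    rewrite (_ : (fun t => _) = *%R (complex.Im c)); first exact: mulrl_continuous.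
    by apply/funext => t; case: c => p q /=; ring.
  rewrite (_ : (fun t => _) = *%R (- complex.Re c)); first exact: mulrl_continuous.
  by apply/funext => t; case: c => p q /=; ring.
- apply/funext => v; rewrite /poisson_path /form2 oppr0.
  by apply: complex_eq; rewrite /=; ring.
have [[bB _] [[bO _] _]] := scaled_symplectic (oner_neq0 R).
have {}bB := (form2P _).1 bB; have {}bO := (form2P _).1 bO.
have O1 : (fun X Y => 1 * Om1 X Y) = Om1.
  by apply/funext => X; apply/funext => Y; rewrite mul1r.
have O2 : (fun X Y => 1 * Om2 X Y) = Om2.
  by apply/funext => X; apply/funext => Y; rewrite mul1r.
have B1 : (fun X Y => - (1 * Om1 X Y)) = (fun X Y => - Om1 X Y).
  by apply/funext => X; apply/funext => Y; rewrite mul1r.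
have dE := deformed_path_symp (mulr1 (1 : R)); rewrite O2 B1 in dE bO bB.
apply/vspaceP => l; apply/idP/idP => [/dE|] lD.
  by apply/(b_transformP _ bB.1 bO.1).
by apply/dE; apply/(b_transformP _ bB.1 bO.1).
Qed.

End Deformation.

Section Automorphisms.
Variables (R : realType) (V : vectType R) (br : V -> V -> V) (w g : V -> V -> R).
Variables (gamma : V -> 'End(V)) (phi : V -> V).
Hypotheses (hbr : is_lie_bracket br) (hw : symplectic_form br w).
Hypothesis hg : nondegenerate_symmetric g.
Hypothesis hgamma : torsion_free_flat_symplectic br w gamma.
Hypothesis hK : pseudo_kahler (sd_bracket br gamma) (@sd_J R V) (sd_Delta g).
Hypothesis hphi : forall a b, g (phi a) b = w a b.
Hypothesis hcond : forall a b, phi (gamma a b) = gamma (phi a) (phi b).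

Local Notation sd := (sd_bracket br gamma).
Local Notation Om1 := (sd_Omega1 w).
Local Notation Om2 := (sd_Omega2 w).

Let bsd := sd_bilin hbr hgamma.
Let bw := w_bilin hbr hw.
Let wskew := w_skew hbr hw.

Lemma g_bilin : bilin_form g.
Proof.
by case: hg => lg sg _; split=> [//|y a x z]; rewrite !(sg _ y) lg.
Qed.
Let bg := g_bilin.
Let gC : forall x y, g x y = g y x. Proof. by case: hg. Qed.

Lemma w_eq x y : (forall z, w x z = w y z) -> x = y.
Proof.
move=> xy; apply/eqP; rewrite -subr_eq0; apply/eqP/hw.2 => z.
by rewrite (flD bw) (flN bw) xy subrr.
Qed.

Lemma phi_linear : linear phi.
Proof.
move=> a x y; apply/eqP; rewrite -subr_eq0; apply/eqP; case: hg => _ _; apply => z.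
by rewrite !(formE bg) !hphi !(formE bw); ring.
Qed.

Lemma phi_skew x y : w (phi x) y = - w x (phi y).
Proof. by rewrite wskew -!hphi gC. Qed.

Lemma phi_surj y : exists x, y = phi x.
Proof.
apply: linear_inj_surj => //; first exact: phi_linear.
by move=> x px; apply: hw.2 => z; rewrite -hphi px (fl0 bg).
Qed.

Lemma gamma_phi2 x y : gamma (phi (phi x)) y = gamma x y.
Proof.
have [z ->] := phi_surj y; rewrite -hcond; apply: w_eq => t.
rewrite phi_skew (w_gamma hgamma) opprK -hcond.
by rewrite [RHS](w_gamma hgamma) phi_skew opprK.
Qed.

(* This is the closedness of the pseudo-Kaehler form evaluated at (phi x, 0),
   (phi y, 0) and (0, z). *)
Lemma kahler_torsion x y : gamma (phi x) y - gamma (phi y) x = br x y.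
Proof.
have [bK _ cK] := (closed_2formP _ bsd (sd_alt gamma hbr)).1 hK.
apply: w_eq => z.
have := cK (phi x, 0) (phi y, 0) (0, z).
rewrite /sd_Delta /sd_J /sd_bracket /= !(torsionE hgamma) -!hcond.
rewrite !(gammaE hgamma) !(formE bg, subr0, sub0r, oppr0) !hphi.
rewrite ![g _ (phi _)]gC !hphi !(formE bw).
have := w_gamma hgamma (phi y) x z; have := w_gamma hgamma (phi x) y z; lra.
Qed.

Definition gamma_p x y := 2^-1 *: (gamma x y + gamma (phi x) y).
Definition gamma_m x y := 2^-1 *: (gamma x y - gamma (phi x) y).
Local Notation gp := gamma_p.
Local Notation gm := gamma_m.

Lemma halfK (x : V) : 2^-1 *: x + 2^-1 *: x = x.
Proof. by rewrite -scalerDl (_ : 2^-1 + 2^-1 = 1 :> R) ?scale1r //; lra. Qed.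

Lemma gamma_pm x y : gamma x y = gp x y + gm x y.
Proof. by rewrite /gp /gm -scalerDr addrACA subrr addr0 scalerDr halfK. Qed.

Lemma gm_sym x y : gm x y = gm y x.
Proof.
have := kahler_torsion x y; rewrite (torsionE hgamma) /gm => /eqP.
rewrite subr_eq => /eqP ->; congr (_ *: _).
by rewrite opprD opprB addrA [X in X - _]addrCA subrr addr0.
Qed.

Lemma gp_bilin : bilin gp.
Proof.
split=> [x|y] a z z'; rewrite /gp.
  rewrite !linearP.
  by rewrite addrACA -scalerDr (scalerDr 2^-1) !scalerA [2^-1 * a]mulrC.
rewrite (linD phi_linear) (linZ phi_linear) !(gammaD hgamma) !(gammaZ hgamma).
by rewrite addrACA -scalerDr (scalerDr 2^-1) !scalerA [2^-1 * a]mulrC.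
Qed.

Lemma gm_bilin : bilin gm.
Proof.
split=> [x|y] a z z'; rewrite /gm.
  rewrite !linearP.
  by rewrite addrACA -scalerDr (scalerDr 2^-1) !scalerA [2^-1 * a]mulrC.
rewrite (linD phi_linear) (linZ phi_linear) !(gammaD hgamma) !(gammaZ hgamma).
by rewrite opprD addrACA -scalerBr (scalerDr 2^-1) !scalerA [2^-1 * a]mulrC.
Qed.

Lemma gp_phil x y : gp (phi x) y = gp x y.
Proof. by rewrite /gp gamma_phi2 addrC. Qed.

Lemma gm_phil x y : gm (phi x) y = - gm x y.
Proof. by rewrite /gm gamma_phi2 -scalerN opprB. Qed.

Lemma gm_phir x y : gm x (phi y) = - gm x y.
Proof. by rewrite gm_sym gm_phil gm_sym. Qed.

Lemma phi_gp x y : phi (gp x y) = gp x (phi y).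
Proof.
by rewrite /gp (linZ phi_linear) (linD phi_linear) !hcond gamma_phi2 addrC.
Qed.

Lemma w_gm x y z : w (gm x y) z = - w y (gm x z).
Proof. by rewrite /gm !(formE bw) !(w_gamma hgamma); ring. Qed.

Lemma phi_gm x y : phi (gm x y) = gm x y.
Proof.
by apply: w_eq => z; rewrite phi_skew w_gm gm_phir (frN bw) !opprK w_gm.
Qed.

(* [spectral A a b]: [A] behaves like a polynomial in [phi] taking the values
   [a] at [1] and [b] at [-1]. *)
Record spectral (A : V -> V) (a b : R) : Prop := Spectral {
  sp_lin : linear A;
  sp_gp : forall x y, A (gp x y) = gp x (A y);
  sp_gpl : forall x y, gp (A x) y = a *: gp x y;
  sp_gml : forall x y, gm (A x) y = b *: gm x y;
  sp_gmr : forall x y, gm x (A y) = b *: gm x y;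
  sp_gm : forall x y, A (gm x y) = a *: gm x y }.

Lemma spectral_id : spectral id 1 1.
Proof. by split=> // *; rewrite scale1r. Qed.

Lemma spectral_phi : spectral phi 1 (- 1).
Proof.
split=> [|x y|x y|x y|x y|x y]; first exact: phi_linear.
- exact: phi_gp.
- by rewrite gp_phil scale1r.
- by rewrite gm_phil scaleN1r.
- by rewrite gm_phir scaleN1r.
by rewrite phi_gm scale1r.
Qed.

Lemma spectral_comp A a b A' a' b' : spectral A a b -> spectral A' a' b' ->
  spectral (fun x => A (A' x)) (a * a') (b * b').
Proof.
move=> [l1 l2 l3 l4 l5 l6] [m1 m2 m3 m4 m5 m6]; split=> [c x y|x y|x y|x y|x y|x y].
- by rewrite m1 l1.
- by rewrite m2 l2.
- by rewrite l3 m3 scalerA.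
- by rewrite l4 m4 scalerA.
- by rewrite l5 m5 scalerA.
by rewrite m6 (linZ l1) l6 scalerA mulrC.
Qed.

Lemma spectral_add c A a b A' a' b' : spectral A a b -> spectral A' a' b' ->
  spectral (fun x => c *: A x + A' x) (c * a + a') (c * b + b').
Proof.
have bp := gp_bilin; have bm := gm_bilin.
move=> [l1 l2 l3 l4 l5 l6] [m1 m2 m3 m4 m5 m6]; split=> [d x y|x y|x y|x y|x y|x y].
- by rewrite m1 l1 scalerDr !scalerA [c * d]mulrC -scalerA addrACA -scalerDr.
- by rewrite l2 m2 (brD bp) (brZ bp).
- by rewrite (blD bp) (blZ bp) l3 m3 scalerA scalerDl.
- by rewrite (blD bm) (blZ bm) l4 m4 scalerA scalerDl.
- by rewrite (brD bm) (brZ bm) l5 m5 scalerA scalerDl.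
by rewrite l6 m6 scalerA scalerDl.
Qed.

Definition block_map (A B C D : V -> V) (X : V * V) : V * V :=
  (A X.1 + B X.2, C X.1 + D X.2).

Section Block.
Variables A B C D : V -> V.
Hypotheses (sA : spectral A 1 0) (sB : spectral B 0 1).
Hypotheses (sC : spectral C 0 (- 1)) (sD : spectral D 1 0).

Lemma block_map_linear : linear (block_map A B C D).
Proof.
move=> a x y; rewrite /block_map (sp_lin sA) (sp_lin sB) (sp_lin sC) (sp_lin sD).
by congr pair; rewrite /= scalerDr addrACA.
Qed.

Lemma block_map_morph X Y :
  block_map A B C D (sd X Y) = sd (block_map A B C D X) (block_map A B C D Y).
Proof.
have bp := gp_bilin; have bm := gm_bilin.
have brE x y : br x y = gp x y - gp y x.
  rewrite (torsionE hgamma) !gamma_pm (gm_sym y x) opprD addrACA subrr addr0 //.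
case: X Y => [x u] [y v]; rewrite /sd_bracket /block_map /=; congr pair.
  rewrite !brE !gamma_pm.
  rewrite !(linB (sp_lin sA), linB (sp_lin sB), linD (sp_lin sB)).
  rewrite !(sp_gp sA, sp_gp sB, sp_gm sB, scale0r, addr0).
  rewrite !(bilE bp) !(sp_gpl sA, sp_gpl sB, scale1r, scale0r, addr0).
  by rewrite opprD addrACA.
rewrite !brE !gamma_pm.
rewrite !(linB (sp_lin sC), linB (sp_lin sD), linD (sp_lin sD)).
rewrite !(sp_gp sC, sp_gp sD, sp_gm sD, scale1r).
rewrite !(bilE bp) !(bilE bm) !(sp_gpl sA, sp_gpl sB, scale1r, scale0r, addr0).
rewrite !(sp_gml sA, sp_gml sB, scale1r, scale0r, add0r).
rewrite !(sp_gmr sC, sp_gmr sD, scaleN1r, scale0r, addr0).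
rewrite (gm_sym u y) (gm_sym v x) !opprD opprK !addrA.
by rewrite [LHS](ACl (1*3*6*2*5*4)).
Qed.

End Block.

Lemma spectral_scale c A a b : spectral A a b ->
  spectral (fun x => c *: A x) (c * a) (c * b).
Proof.
have bp := gp_bilin; have bm := gm_bilin.
move=> [l1 l2 l3 l4 l5 l6]; split=> [d x y|x y|x y|x y|x y|x y].
- by rewrite l1 scalerDr !scalerA [c * d]mulrC.
- by rewrite l2 (brZ bp).
- by rewrite (blZ bp) l3 scalerA.
- by rewrite (blZ bm) l4 scalerA.
- by rewrite (brZ bm) l5 scalerA.
by rewrite l6 scalerA.
Qed.

Lemma spectral_eq A a b a' b' : spectral A a b -> a = a' -> b = b' -> spectral A a' b'.
Proof. by move=> ? <- <-. Qed.

Definition spec_m x := (- 2^-1) *: phi x + 2^-1 *: x.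
Definition spec_p x := 2^-1 *: phi x + 2^-1 *: x.
Local Notation s := spec_m.
Local Notation e := spec_p.

Lemma spectral_m : spectral s 0 1.
Proof.
apply: (spectral_eq (spectral_add (- 2^-1) spectral_phi
  (spectral_scale 2^-1 spectral_id))); by field.
Qed.

Lemma spectral_p : spectral e 1 0.
Proof.
apply: (spectral_eq (spectral_add 2^-1 spectral_phi
  (spectral_scale 2^-1 spectral_id))); by field.
Qed.

Lemma w_spec x y : w (s x) y = w x (e y).
Proof. by rewrite /s /e !(formE bw) phi_skew; ring. Qed.

(* With s = (1 - phi) / 2 and e = (1 + phi) / 2 = 1 - s, which is the adjoint of s
   for w, the left matrix is U L U, where U and L are the elementary matrices
   with off-diagonal entries s and - s; it interpolates between the identity at
   phi = 1 and a quarter turn at phi = - 1.  The right one is then forced by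
   [swap_Omega]. *)
Definition swap_left := block_map
  (fun x => (- 1) *: s (s x) + x) (fun x => (- 1) *: s (s (s x)) + 2 *: s x)
  (fun x => (- 1) *: s x) (fun x => (- 1) *: s (s x) + x).

Definition swap_right := block_map
  e (fun x => (- 1) *: e (e x) + x)
  (fun x => e (e x) - x) (fun x => (- 1) *: e (e (e x)) + 2 *: e x).

Let s2 := spectral_comp spectral_m spectral_m.
Let s3 := spectral_comp spectral_m s2.
Let e2 := spectral_comp spectral_p spectral_p.
Let e3 := spectral_comp spectral_p e2.

Let sA : spectral (fun x => (- 1) *: s (s x) + x) 1 0.
Proof. by apply: (spectral_eq (spectral_add (- 1) s2 spectral_id)); ring. Qed.
Let sB : spectral (fun x => (- 1) *: s (s (s x)) + 2 *: s x) 0 1.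
Proof.
by apply: (spectral_eq (spectral_add (- 1) s3 (spectral_scale 2 spectral_m))); ring.
Qed.
Let sC : spectral (fun x => (- 1) *: s x) 0 (- 1).
Proof. by apply: (spectral_eq (spectral_scale (- 1) spectral_m)); ring. Qed.
Let eB : spectral (fun x => (- 1) *: e (e x) + x) 0 1.
Proof. by apply: (spectral_eq (spectral_add (- 1) e2 spectral_id)); ring. Qed.
Let eC : spectral (fun x => e (e x) - x) 0 (- 1).
Proof.
have -> : (fun x => e (e x) - x) = (fun x => (- 1) *: x + e (e x)).
  by apply/funext => x; rewrite scaleN1r addrC.
by apply: (spectral_eq (spectral_add (- 1) spectral_id e2)); ring.
Qed.
Let eD : spectral (fun x => (- 1) *: e (e (e x)) + 2 *: e x) 1 0.
Proof.
by apply: (spectral_eq (spectral_add (- 1) e3 (spectral_scale 2 spectral_p))); ring.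
Qed.

Lemma swap_left_linear : linear swap_left.
Proof. exact: block_map_linear sA sB sC sA. Qed.
Lemma swap_right_linear : linear swap_right.
Proof. exact: block_map_linear spectral_p eB eC eD. Qed.
Lemma swap_left_morph X Y : swap_left (sd X Y) = sd (swap_left X) (swap_left Y).
Proof. exact: block_map_morph sA sB sC sA X Y. Qed.
Lemma swap_right_morph X Y : swap_right (sd X Y) = sd (swap_right X) (swap_right Y).
Proof. exact: block_map_morph spectral_p eB eC eD X Y. Qed.

Lemma swap_Omega X Y : Om2 (swap_left X) (swap_right Y) = Om1 X Y.
Proof.
case: X Y => [x u] [y v]; rewrite /sd_Omega1 /sd_Omega2 /swap_left /swap_right /=.
(* Generalizing prevents [formE] from unfolding the two maps. *)
move: spec_m spec_p w_spec => sm sp wE.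
by rewrite !(formE bw) !wE; ring.
Qed.

Lemma complex_dga_iso_symplectic :
  dga_iso sd (gcs_complex (@sd_J R V)) (gcs_symplectic Om2).
Proof.
have fr1 := real_frame_frame bsd (complex_real_frame hbr hw hgamma) (gcs_complexP hbr hw).
have asd := sd_alt gamma hbr.
have z0 : closed_2form sd (fun _ _ => 0).
  apply/(closed_2formP _ bsd asd); split=> [|//|X Y Z]; last by rewrite !addr0.
  exact: zero_bilin_form.
have fr2 := real_frame_frame bsd (symplectic_real_frame bsd asd z0
  (conj (Om2_closed hbr hw hgamma) (Om2_nondegenerate hbr hw)))
  (fun l => gcs_symplecticP l (Om2_bilin hbr hw)).
have cmorph (f : V * V -> V * V) : linear f ->
    (forall X Y, f (sd X Y) = sd (f X) (f Y)) ->
    forall X Y, cmap f (cbil sd X Y) = cbil sd (cmap f X) (cmap f Y).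
  move=> lf mf X Y; apply: cplx_eq; rewrite /= ?(linB lf) ?(linD lf) !mf //.
apply: (frame_dga_iso _ fr1); first exact: cbil_bilin.
apply: (gcs_frame_comp fr2 (cmap_linear swap_left_linear) _
  (cmap_linear swap_right_linear)).
- exact: cmorph swap_left_linear swap_left_morph.
- exact: cmorph swap_right_linear swap_right_morph.
- by move=> X Y; congr (_ * _); apply: complex_eq; rewrite /= !swap_Omega.
- exact: gf_nondegl fr1.
exact: gf_nondegr fr1.
Qed.

End Automorphisms.

Theorem theorem5 (R : realType) (V : vectType R)
    (br : V -> V -> V) (w g : V -> V -> R) (gamma : V -> 'End(V)) (phi : V -> V)
    (hbr : is_lie_bracket br)
    (hw : symplectic_form br w)
    (hg : nondegenerate_symmetric g)
    (hgamma : torsion_free_flat_symplectic br w gamma)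
    (hK : pseudo_kahler (sd_bracket br gamma) (@sd_J R V) (sd_Delta g))
    (* phi is the map g^{-1} w *)
    (hphi : forall a b, g (phi a) b = w a b)
    (hcond : forall a b, phi (gamma a b) = gamma (phi a) (phi b)) :
  (exists B : V * V -> V * V -> R,
     closed_2form (sd_bracket br gamma) B /\
     deforms_to (sd_bracket br gamma)
       (gcs_complex (@sd_J R V))
       (b_transform B (gcs_symplectic (sd_Omega2 w)))) /\
  dga_iso (sd_bracket br gamma)
    (gcs_complex (@sd_J R V)) (gcs_symplectic (sd_Omega2 w)).
Proof.
split; last exact: complex_dga_iso_symplectic hbr hw hg hgamma hK hphi hcond.
exists (fun X Y => - sd_Omega1 w X Y); split.
  have [cB _] := scaled_symplectic hbr hw hgamma (oner_neq0 R).
  rewrite (_ : (fun X Y => - sd_Omega1 w X Y) =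
    (fun X Y => - (1 * sd_Omega1 w X Y))) //.
  by apply/funext => X; apply/funext => Y; rewrite mul1r.
exact: complex_deforms_to_symplectic hbr hw hgamma.
Qed.
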